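(* Let $K=\mathbb{Q}[\alpha]$, where $\alpha$ is a root of $x^3+4x-1$, so that $\mathcal{O}_K=\mathbb{Z}[\alpha]$. Let $P=(3,\,2+2\alpha+\alpha^2)$ be the ideal of $\mathcal{O}_K$ generated by $3$ and $2+2\alpha+\alpha^2$, let $I=P^2$ and let $R=\mathbb{Z}+I$. Then $R$ is a half-factorial order in the number field $K$ for which $R[[x]]$ is not an HFD.
   Context: An order $R$ in a number field $K$ is a subring (with $1$) of the ring of integers $\mathcal{O}_K$ that has rank $[K:\mathbb{Q}]$ as a $\mathbb{Z}$-module. A half-factorial domain (HFD) is an integral domain that is atomic (every nonzero nonunit is a finite product of irreducibles) and in which any two factorizations of the same element into irreducibles have the same number of factors; an order is half-factorial if it is an HFD. $R[[x]]$ is the ring of formal power series in one variable. *)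

(* Defs.v *)
From HB Require Import structures.
From mathcomp Require Import all_boot all_algebra all_field.
From mathcomp Require Import boolp.

Set Implicit Arguments.
Unset Strict Implicit.
Unset Printing Implicit Defensive.

Import GRing.Theory.
Local Open Scope ring_scope.

(* Half-factorial domains.  The library's [GRing.unit] and [idomainType] need  *)
(* a chosen inverse operation, so units are spelled out here and being a       *)
(* domain is a property of a commutative ring.                                 *)

Section HalfFactorial.
Variable A : comNzRingType.
Implicit Types (x y a b : A) (s t : seq A).

Definition is_unit x : Prop := exists y, x * y = 1.

Definition irreducible x : Prop :=
  [/\ x <> 0, ~ is_unit x & forall a b, x = a * b -> is_unit a \/ is_unit b].

Definition atomic : Prop :=
  forall x, x <> 0 -> ~ is_unit x ->
  exists2 s, {in s, forall y, irreducible y} & x = \prod_(y <- s) y.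

Definition equal_factorization_lengths : Prop :=
  forall s t, {in s, forall y, irreducible y} ->
    {in t, forall y, irreducible y} ->
    \prod_(y <- s) y = \prod_(y <- t) y -> size s = size t.

Definition HFD : Prop :=
  [/\ GRing.integral_domain_axiom A, atomic & equal_factorization_lengths].

End HalfFactorial.

(* [FPS f] stands for the series [\sum_n f n * x ^ n].                         *)

Record fps (A : Type) := FPS { fps_coef : nat -> A }.

HB.instance Definition _ (A : Type) := gen_eqMixin (fps A).
HB.instance Definition _ (A : Type) := gen_choiceMixin (fps A).

Section PowerSeriesRing.
Variable A : comNzRingType.
Implicit Types f g h : fps A.

Lemma fpsP f g : fps_coef f =1 fps_coef g -> f = g.
Proof. by case: f g => f [g] /= /funext ->. Qed.

Definition fps_zero : fps A := FPS (fun=> 0).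
Definition fps_one : fps A := FPS (fun n => (n == 0%N)%:R).
Definition fps_opp f : fps A := FPS (fun n => - fps_coef f n).
Definition fps_add f g : fps A := FPS (fun n => fps_coef f n + fps_coef g n).
Definition fps_mul f g : fps A :=
  FPS (fun n => \sum_(i < n.+1) fps_coef f i * fps_coef g (n - i)).

Fact fps_addA : associative fps_add.
Proof. by move=> f g h; apply: fpsP => n /=; rewrite addrA. Qed.

Fact fps_addC : commutative fps_add.
Proof. by move=> f g; apply: fpsP => n /=; rewrite addrC. Qed.

Fact fps_add0 : left_id fps_zero fps_add.
Proof. by move=> f; apply: fpsP => n /=; rewrite add0r. Qed.

Fact fps_addN : left_inverse fps_zero fps_opp fps_add.
Proof. by move=> f; apply: fpsP => n /=; rewrite addNr. Qed.

HB.instance Definition _ :=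
  GRing.isZmodule.Build (fps A) fps_addA fps_addC fps_add0 fps_addN.

(* The multiplicative laws are inherited from {poly A} by truncation.          *)
Let trunc n f : {poly A} := \poly_(i < n.+1) fps_coef f i.

Let coef_trunc n f i : (i <= n)%N -> (trunc n f)`_i = fps_coef f i.
Proof. by move=> le_in; rewrite coef_poly ltnS le_in. Qed.

Let coef_mul n f g i : (i <= n)%N ->
  fps_coef (fps_mul f g) i = (trunc n f * trunc n g)`_i.
Proof.
move=> le_in; rewrite coefM; apply: eq_bigr => j _ /=.
have le_jn : (j <= n)%N by apply: leq_trans le_in; rewrite -ltnS.
by rewrite !coef_trunc // (leq_trans (leq_subr _ _)).
Qed.

Fact fps_mulC : commutative fps_mul.
Proof.
by move=> f g; apply: fpsP => n; rewrite !(coef_mul _ _ (leqnn n)) mulrC.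
Qed.

Fact fps_mulA : associative fps_mul.
Proof.
move=> f g h; apply: fpsP => n.
transitivity (trunc n f * (trunc n g * trunc n h))`_n.
  rewrite /= coefM; apply: eq_bigr => i _.
  by rewrite coef_trunc -1?ltnS // -(coef_mul _ _ (leq_subr i n)).
rewrite mulrA /= coefM; apply: eq_bigr => i _.
by rewrite coef_trunc ?leq_subr // -coef_mul // -ltnS.
Qed.

Fact fps_mul1 : left_id fps_one fps_mul.
Proof.
move=> f; apply: fpsP => n /=.
rewrite big_ord_recl /= mul1r subn0 big1 ?addr0 // => i _.
by rewrite mul0r.
Qed.

Fact fps_mulDl : left_distributive fps_mul fps_add.
Proof.
move=> f g h; apply: fpsP => n /=; rewrite -big_split /=.
by apply: eq_bigr => i _; rewrite mulrDl.
Qed.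

Fact fps_one_neq0 : fps_one != 0.
Proof.
by apply/eqP => /(congr1 (@fps_coef A)) /(congr1 (@^~ 0%N)) /eqP; rewrite oner_eq0.
Qed.

HB.instance Definition _ := GRing.Zmodule_isComNzRing.Build (fps A)
  fps_mulA fps_mulC fps_mul1 fps_mulDl fps_one_neq0.

End PowerSeriesRing.

Section NumberField.
Variable K : fieldExtType rat.
Implicit Types (x alpha : K) (I J M : {pred K}).

Definition ring_of_integers : {pred K} :=
  [pred x | `[< integralOver (intr : int -> K) x >]].

Definition Zfree n (v : 'I_n -> K) : Prop :=
  forall c : 'I_n -> int, \sum_i v i *~ c i = 0 -> forall i, c i = 0.

(* The rank of an additive subgroup M of K is the largest size of a            *)
(* Z-linearly independent family in M.                                         *)
Definition has_Zrank M n : Prop :=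
  (exists2 v : 'I_n -> K, forall i, v i \in M & Zfree v) /\
  (forall m (v : 'I_m -> K), (forall i, v i \in M) -> Zfree v -> (m <= n)%N).

Record number_order := NumberOrder {
  order_pred :> K -> bool;
  order_subring : subring_closed order_pred;
  order_integral : {subset order_pred <= ring_of_integers};
  order_rank : has_Zrank order_pred (\dim {:K})
}.

HB.instance Definition _ (R : number_order) :=
  GRing.isSubringClosed.Build K (order_pred R) (order_subring R).

Definition Z_adjoin alpha : {pred K} :=
  [pred x | `[< exists p : {poly int}, x = (map_poly intr p).[alpha] >]].

(* Ideals are taken in the ring of integers of K.                              *)
Definition ideal_gen (s : seq K) : {pred K} :=
  [pred x | `[< exists2 c : nat -> K,
      forall i, c i \in ring_of_integers
      & x = \sum_(i < size s) c i * s`_i >]].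

Definition ideal_mul I J : {pred K} :=
  [pred x | `[< exists2 s : seq (K * K),
      {in s, forall p, p.1 \in I /\ p.2 \in J}
      & x = \sum_(p <- s) p.1 * p.2 >]].

Definition Z_plus I : {pred K} :=
  [pred x | `[< exists n : int, exists2 y, y \in I & x = n%:~R + y >]].

End NumberField.

Arguments ring_of_integers : clear implicits.

(* An order viewed as a ring in its own right.                                 *)

Section OrderRing.
Variables (K : fieldExtType rat) (R : number_order K).

Record order_ring : predArgType :=
  OrderElt { order_val : K; order_valP : order_val \in order_pred R }.

HB.instance Definition _ := [isSub for order_val].
HB.instance Definition _ := [Choice of order_ring by <:].
HB.instance Definition _ := [SubChoice_isSubComNzRing of order_ring by <:].

End OrderRing.

(* Main.v *)
From Stdlib Require Import BinInt.
From HB Require Import structures.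
Require Import Defs.
From mathcomp Require Import all_boot all_order all_algebra all_field.
From mathcomp Require Import boolp.
From mathcomp Require Import ring lra zify ssrZ.
From mathcomp Require Import realalg.

(** Write O for the ring of integers of K, P for the given prime ideal of norm
    9, I = P^2 and R = Z + I.

    The class number of O is 2. Euclid's algorithm works if a quotient may be
    multiplied by 1 - alpha before it is rounded ([norm_cover]). Let A be the
    prime ideal of norm 2. Then theta = (1 + alpha) / 3 generates A P^-1, and
    theta ^+ 2 varpi = 1 - alpha with P^2 = varpi O and A^2 = (1 - alpha).
    Comparing elements of minimal norm in J and in J P shows that every
    fractional ideal J is a multiple of O or of P ([class_number_two]), and P is
    not principal because no element of O has norm 2 or -2 ([norm_form_neq2]). It
    follows that Z[alpha] is integrally closed and that ideals have unique
    factorization. As the square of an ideal is principal, an ideal is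
    represented by a generator of its square ([divisor]).

    R is half-factorial. Give weight 2 to a principal prime ideal and weight 1
    to the others. Every element of O is a power of the unit alpha times an
    element of R ([unit_mul_orderR]). Therefore a principal factor prime to P of
    an irreducible of R is, up to a unit, all of it ([orderR_cofactor]), and no
    irreducible is a product of an element of P and an element of I
    ([orderR_not_P3]). This leaves for an irreducible a single principal prime
    or a pair of nonprincipal ones, so the total weight is 2
    ([irreducible_weight_two]), and the length of a factorization is half of the
    total weight of the element.

    For power series the unit argument breaks down: let d = 3 alpha, which is in
    P but not in R. In O[[X]] the series varpi (X + d) has the factor X + d,
    which is not divisible by P, but a factor over R that is associated to X + d
    would force d to be in R. So varpi (X + d) and varpi (X - d) are irreducible
    over R ([linear_irreducible]), while their product is also the product of
    varpi, varpi and X ^+ 2 - d ^+ 2, three nonunits of R[[X]], since d ^+ 2 is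
    in I. *)

Set Implicit Arguments.
Unset Strict Implicit.
Unset Printing Implicit Defensive.

Import Order.TTheory GRing.Theory Num.Theory.
Local Open Scope ring_scope.
Delimit Scope Z_scope with BZ.

(** * The norm form and a covering of the unit cube *)

(** The norm from Q(alpha) to Q of a + b alpha + c alpha ^+ 2. *)
Definition norm_form (R : pzRingType) (a b c : R) : R :=
  a * (a - 4 * c) ^+ 2 - 3 * (a * b * c) + 4 * (a * b ^+ 2)
  + b ^+ 3 + c ^+ 3 + 4 * (b * c ^+ 2).
Arguments norm_form {R}.

(** Taylor's bound for the cubic form on the box of half-width h centred at (a,
    b, c); 38 is the sum of the absolute values of the coefficients of the
    third-order part. *)
Definition norm_bound (R : realDomainType) (a b c h : R) : R :=
  `|norm_form a b c|
  + h * (`|3 * a ^+ 2 - 16 * (a * c) + 16 * c ^+ 2 - 3 * (b * c) + 4 * b ^+ 2|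
       + `|8 * (a * b) - 3 * (a * c) + 3 * b ^+ 2 + 4 * c ^+ 2|
       + `|32 * (a * c) - 8 * a ^+ 2 - 3 * (a * b) + 3 * c ^+ 2 + 8 * (b * c)|)
  + h ^+ 2 * (`|3 * a - 8 * c| + `|8 * b - 3 * c| + `|32 * c - 16 * a - 3 * b|
       + `|4 * a + 3 * b| + `|8 * c - 3 * a| + `|16 * a + 3 * c + 4 * b|)
  + 38 * h ^+ 3.
Arguments norm_bound {R}.

Lemma norm_form_taylor (R : realDomainType) (a b c x y z h : R) :
    `|x| <= h -> `|y| <= h -> `|z| <= h ->
  `|norm_form (a + x) (b + y) (c + z)| <= norm_bound a b c h.
Proof.
move=> hx hy hz; have h0 : 0 <= h := le_trans (normr_ge0 x) hx.
have mul1 s (u : R) : `|u| <= h -> `|u * s| <= h * `|s|.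
  by move=> hu; rewrite normrM ler_wpM2r.
have mul2 s (u v : R) : `|u| <= h -> `|v| <= h -> `|u * v * s| <= h ^+ 2 * `|s|.
  by move=> hu hv; rewrite !normrM ler_wpM2r // expr2 ler_pM.
have mul3 (n : nat) (u v w : R) : `|u| <= h -> `|v| <= h -> `|w| <= h ->
    `|u * v * w * n%:R| <= h ^+ 3 * n%:R.
  move=> hu hv hw; rewrite !normrM normr_nat ler_wpM2r // !exprS expr0 mulr1 mulrA.
  by rewrite !ler_pM // mulr_ge0.
have -> : norm_form (a + x) (b + y) (c + z) = norm_form a b c
  + (x * (3 * a ^+ 2 - 16 * (a * c) + 16 * c ^+ 2 - 3 * (b * c) + 4 * b ^+ 2)
     + y * (8 * (a * b) - 3 * (a * c) + 3 * b ^+ 2 + 4 * c ^+ 2)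
     + z * (32 * (a * c) - 8 * a ^+ 2 - 3 * (a * b) + 3 * c ^+ 2 + 8 * (b * c)))
  + (x * x * (3 * a - 8 * c) + x * y * (8 * b - 3 * c)
     + x * z * (32 * c - 16 * a - 3 * b) + y * y * (4 * a + 3 * b)
     + y * z * (8 * c - 3 * a) + z * z * (16 * a + 3 * c + 4 * b))
  + (x * x * x * 1%:R - x * x * z * 8%:R + x * z * z * 16%:R - x * y * z * 3%:R
     + x * y * y * 4%:R + y * y * y * 1%:R + z * z * z * 1%:R + y * z * z * 4%:R).
  rewrite /norm_form; ring.
rewrite /norm_bound.
have -> : 38 * h ^+ 3 = h ^+ 3 * 1%:R + h ^+ 3 * 8%:R + h ^+ 3 * 16%:R
  + h ^+ 3 * 3%:R + h ^+ 3 * 4%:R + h ^+ 3 * 1%:R + h ^+ 3 * 1%:R + h ^+ 3 * 4%:R.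
  ring.
rewrite !(mulrDr h) !(mulrDr (h ^+ 2)).
do !(apply: (le_trans (ler_normD _ _)); apply: lerD);
  rewrite ?normrN //; do ?[exact: mul1 | exact: mul2 | exact: mul3].
Qed.

Local Open Scope Z_scope.

(** The previous bound over binary integers, with shared subexpressions, so that
    it can be evaluated many times by the kernel. *)
Definition norm_boundZ (a b c h : Z) : Z :=
  let aa := a * a in let bb := b * b in let cc := c * c in
  let ab := a * b in let ac := a * c in let bc := b * c in let hh := h * h in
  Z.abs (a * ((a - 4 * c) * (a - 4 * c)) - 3 * (ab * c) + 4 * (a * bb)
         + b * bb + c * cc + 4 * (b * cc))
  + h * (Z.abs (3 * aa - 16 * ac + 16 * cc - 3 * bc + 4 * bb)
       + Z.abs (8 * ab - 3 * ac + 3 * bb + 4 * cc)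
       + Z.abs (32 * ac - 8 * aa - 3 * ab + 3 * cc + 8 * bc))
  + hh * (Z.abs (3 * a - 8 * c) + Z.abs (8 * b - 3 * c)
       + Z.abs (32 * c - 16 * a - 3 * b) + Z.abs (4 * a + 3 * b)
       + Z.abs (8 * c - 3 * a) + Z.abs (16 * a + 3 * c + 4 * b))
  + 38 * (h * hh).

(** Points of (1 - alpha)^-1 O in units of 1/32, each with the norm allowed for
    a difference to it in units of 1/32^3. The allowance is 1 at the integers 0,
    1, -1, alpha, -alpha, and 1/4 at the eight points with coordinates 1/2 or
    -1/2, because 1 - alpha has norm 4 and multiplies these points into O. *)
Definition cover_points : seq (Z * Z * Z * Z) :=
  [seq (32 * p.1.1, 32 * p.1.2, 32 * p.2, 32 * 32 * 32)
    | p <- [:: (0, 0, 0); (1, 0, 0); (-1, 0, 0); (0, 1, 0); (0, -1, 0)]]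
  ++ [seq (16 * p.1.1, 16 * p.1.2, 16 * p.2, 8 * 32 * 32)
    | p <- [:: (1, 1, 1); (1, 1, -1); (1, -1, 1); (1, -1, -1);
               (-1, 1, 1); (-1, 1, -1); (-1, -1, 1); (-1, -1, -1)]].

(** A box that does not lie in the norm neighbourhood of a single cover point is
    cut into eight boxes, whose half-widths are the next entry of hs. *)
Fixpoint box_covered (hs : seq Z) (h p q r : Z) : bool :=
  has (fun u => Z.ltb (norm_boundZ (p - u.1.1.1) (q - u.1.1.2) (r - u.1.2) h) u.2)
    cover_points
  || (if hs is k :: hs' then
        (h =? k + k) && all (fun s => box_covered hs' k (p + s.1.1 * k) (q + s.1.2 * k)
                        (r + s.2 * k))
          [:: (1, 1, 1); (1, 1, -1); (1, -1, 1); (1, -1, -1);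
              (-1, 1, 1); (-1, 1, -1); (-1, -1, 1); (-1, -1, -1)]
      else false).

Lemma unit_box_covered : box_covered [:: 8; 4; 2; 1] 16 0 0 0.
Proof. by vm_compute. Qed.

Local Close Scope Z_scope.

Definition ratZ (z : Z) : rat := (int_of_Z z)%:~R.

Lemma ratZD y z : ratZ (y + z)%BZ = ratZ y + ratZ z.
Proof. by rewrite /ratZ (rmorphD int_of_Z) rmorphD. Qed.

Lemma ratZN z : ratZ (- z)%BZ = - ratZ z.
Proof. by rewrite /ratZ (rmorphN int_of_Z) rmorphN. Qed.

Lemma ratZB y z : ratZ (y - z)%BZ = ratZ y - ratZ z.
Proof. by rewrite -ratZN -ratZD. Qed.

Lemma ratZM y z : ratZ (y * z)%BZ = ratZ y * ratZ z.
Proof. by rewrite /ratZ (rmorphM int_of_Z) rmorphM. Qed.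

Lemma ratZ_lt y z : (y <? z)%BZ -> ratZ y < ratZ z.
Proof. by rewrite /ratZ ltr_int; lia. Qed.

Lemma ratZ_abs z : ratZ (Z.abs z) = `|ratZ z|.
Proof. by rewrite /ratZ -intr_norm; congr (_%:~R); lia. Qed.

Lemma ratZ_norm_bound a b c h :
  ratZ (norm_boundZ a b c h) = norm_bound (ratZ a) (ratZ b) (ratZ c) (ratZ h).
Proof.
rewrite /norm_boundZ !(ratZD, ratZB, ratZM, ratZ_abs).
rewrite /norm_bound /norm_form; congr (`|_| + _ * (`|_| + `|_| + `|_|) +
  _ * (`|_| + `|_| + `|_| + `|_| + `|_| + `|_|) + _);
  rewrite -?[ratZ 3]/(3 : rat) -?[ratZ 4]/(4 : rat) -?[ratZ 16]/(16 : rat)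
    -?[ratZ 8]/(8 : rat) -?[ratZ 32]/(32 : rat) -?[ratZ 38]/(38 : rat); ring.
Qed.

Lemma box_covered_sound hs h p q r (x y z : rat) : box_covered hs h p q r ->
    `|32 * x - ratZ p| <= ratZ h -> `|32 * y - ratZ q| <= ratZ h ->
    `|32 * z - ratZ r| <= ratZ h ->
  exists2 u, u \in cover_points &
    `|norm_form (32 * x - ratZ u.1.1.1) (32 * y - ratZ u.1.1.2)
        (32 * z - ratZ u.1.2)| < ratZ u.2.
Proof.
elim: hs h p q r => [|k hs IHhs] h p q r /orP[]; [|move/notF=> [] | |].
3: {
  case/andP=> /Z.eqb_eq-> /allP cov; rewrite ratZD.
  have half (t : rat) m : `|t - ratZ m| <= ratZ k + ratZ k ->
      exists2 s, s \in [:: 1; -1]%BZ & `|t - ratZ (m + s * k)%BZ| <= ratZ k.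
    rewrite ler_norml => /andP[le1 le2].
    have [le_mt|] := boolP (ratZ m <= t); last rewrite -ltNge => /ltW le_tm.
      exists 1%BZ => //; rewrite ratZD ratZM [ratZ 1]/(1 : rat) mul1r.
      by move: (ratZ m) (ratZ k) le1 le2 le_mt => *; rewrite ler_norml; lra.
    exists (-1)%BZ => //; rewrite ratZD ratZM [ratZ (-1)]/(-1 : rat) mulN1r.
    by move: (ratZ m) (ratZ k) le1 le2 le_tm => *; rewrite ler_norml; lra.
 case/half=> s1 Ds1 le1 /half[s2 Ds2 le2] /half[s3 Ds3 le3].
  have: box_covered hs k (p + s1 * k) (q + s2 * k) (r + s3 * k).
    apply: (cov (s1, s2, s3)).
    by case/predU1P: Ds1 => [|/predU1P[|//]]->;
       case/predU1P: Ds2 => [|/predU1P[|//]]->;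
       case/predU1P: Ds3 => [|/predU1P[|//]]->.
  by move/IHhs/(_ le1 le2 le3). }
all: case/hasP=> u cov_u /ratZ_lt; rewrite ratZ_norm_bound => lt_u le_x le_y le_z.
all: exists u; first exact: cov_u.
all: rewrite !ratZB in lt_u; refine (le_lt_trans _ lt_u).
all: have E (a b c : rat) : a - c = b - c + (a - b) by ring.
all: rewrite (E (32 * x) (ratZ p)) (E (32 * y) (ratZ q)) (E (32 * z) (ratZ r)).
all: exact: norm_form_taylor.
Qed.

Local Arguments Z.mul : simpl never.
Local Arguments ratZ : simpl never.

(** A form of Euclid's algorithm. A quotient may have no integer within norm
    distance 1, but one exists after multiplication by 1 - alpha if necessary:
    translating by integers brings (x, y, z) into the cube of side 1 centred at
    0, and that cube is covered by finitely many norm neighbourhoods. *)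
Lemma norm_cover (x y z : rat) : exists p q r : int,
  `|norm_form (x - p%:~R) (y - q%:~R) (z - r%:~R)| < 1 \/
  `|norm_form (x - z - p%:~R) (y - x + 4 * z - q%:~R) (z - y - r%:~R)| < 1.
Proof.
have near t : exists m : int, `|32 * (t - m%:~R)| <= 16 :> rat.
  exists (Num.floor (t + 1 / 2)).
  have /andP[] := floor_itv (t + 1 / 2); rewrite intrD ler_norml => *.
  by apply/andP; split; lra.
have [[l lx] [m my] [n nz]] := And3 (near x) (near y) (near z).
have := @box_covered_sound [:: 8; 4; 2; 1]%BZ 16 0 0 0
  (x - l%:~R) (y - m%:~R) (z - n%:~R) unit_box_covered.
rewrite [ratZ 0]/(0 : rat) [ratZ 16]/(16 : rat) !subr0 => /(_ lx my nz)[u].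
rewrite mem_cat => /orP[] /mapP[[[i j] k]] /=.
  move=> _ ->; rewrite /= !ratZM [ratZ 32]/(32 : rat).
  have gt0 : 0 < 32 * 32 * 32 :> rat by rewrite !mulr_gt0 ?ltr0n.
  have -> : norm_form (32 * (x - l%:~R) - 32 * ratZ i) (32 * (y - m%:~R) - 32 * ratZ j)
      (32 * (z - n%:~R) - 32 * ratZ k) = 32 * 32 * 32 *
    norm_form (x - (l + int_of_Z i)%:~R) (y - (m + int_of_Z j)%:~R)
      (z - (n + int_of_Z k)%:~R).
    by rewrite !intrD -!/(ratZ _) /norm_form; ring.
  rewrite normrM (gtr0_norm gt0) -[ltRHS]mulr1 (ltr_pM2l gt0) => lt1.
  by exists (l + int_of_Z i), (m + int_of_Z j), (n + int_of_Z k); left.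
move=> Dijk ->; rewrite /= !ratZM [ratZ 16]/(16 : rat) [ratZ 8]/(8 : rat) [ratZ 32]/(32 : rat).
have [a [b [c [Da Db Dc]]]] : exists a b c : int,
    [/\ ratZ i - ratZ k = 2 * a%:~R, ratZ j - ratZ i + 4 * ratZ k = 2 * b%:~R
      & ratZ k - ratZ j = 2 * c%:~R].
  have i1 : ratZ 1 = 1 by [].
  have iN : ratZ (-1) = -1 by [].
  move: Dijk; rewrite !inE.
  do ![case/predU1P=> [[-> -> ->]|]]; last move/eqP=> [-> -> ->].
  - by exists 0, 2, 0; rewrite ?i1 ?iN; split; ring.
  - by exists 1, (-2), (-1); rewrite ?i1 ?iN; split; ring.
  - by exists 0, 1, 1; rewrite ?i1 ?iN; split; ring.
  - by exists 1, (-3), 0; rewrite ?i1 ?iN; split; ring.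
  - by exists (-1), 3, 0; rewrite ?i1 ?iN; split; ring.
  - by exists 0, (-1), (-1); rewrite ?i1 ?iN; split; ring.
  - by exists (-1), 2, 1; rewrite ?i1 ?iN; split; ring.
  - by exists 0, (-2), 0; rewrite ?i1 ?iN; split; ring.
move=> lt1; exists (l - n + a), (m - l + 4 * n + b), (n - m + c); right.
move: lt1; have gt0 : 0 < 8 * 32 * 32 :> rat by rewrite !mulr_gt0 ?ltr0n.
have -> : norm_form (32 * (x - l%:~R) - 16 * ratZ i) (32 * (y - m%:~R) - 16 * ratZ j)
    (32 * (z - n%:~R) - 16 * ratZ k) = 8 * 32 * 32 *
  norm_form (x - z - (l - n + a)%:~R) (y - x + 4 * z - (m - l + 4 * n + b)%:~R)
    (z - y - (n - m + c)%:~R).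
  have Ea : a%:~R = (ratZ i - ratZ k) / 2 by rewrite Da; field.
  have Eb : b%:~R = (ratZ j - ratZ i + 4 * ratZ k) / 2 by rewrite Db; field.
  have Ec : c%:~R = (ratZ k - ratZ j) / 2 by rewrite Dc; field.
  rewrite !(intrD, intrB, intrM) Ea Eb Ec /norm_form.
  by move: (ratZ i) (ratZ j) (ratZ k) => I J K; field.
by rewrite normrM (gtr0_norm gt0) -[ltRHS]mulr1 (ltr_pM2l gt0).
Qed.

(** * No element of norm 2 *)

Lemma normz_lt1 (n : int) : `|n| < 1 -> n = 0.
Proof. lia. Qed.

Lemma normz_lt2 (n : int) : `|n| < 2 -> `|n| <= 1.
Proof. lia. Qed.

(** K has one real and one complex place, and the norm is the product of the
    real value and the squared complex absolute value. The real value of the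
    unit alpha is r, about 0.246, so an element of norm 2 can be multiplied by a
    power of alpha so that both factors are bounded; this leaves the elements a
    + b alpha with a, b in {-1, 0, 1}, none of which has norm 2 or -2. *)
Section RealPlace.
Variables (F : archiRcfType) (r : F).
Hypotheses (root_r : r ^+ 3 + 4 * r = 1) (r_ge : 123 / 500 <= r) (r_le : r <= 1 / 4).

(** If z is a complex conjugate of alpha, then z has real part - r / 2 and
    absolute value squared 4 + r ^+ 2; hence [complex_place] is |a + b z + c
    z ^+ 2|^2 as a sum of the squares of the real and the imaginary part. *)
Let real_place (a b c : int) : F := a%:~R + b%:~R * r + c%:~R * r ^+ 2.
Let complex_place (a b c : int) : F :=
  (a%:~R - b%:~R * r / 2 - c%:~R * (4 + r ^+ 2 / 2)) ^+ 2
  + (4 + 3 / 4 * r ^+ 2) * (b%:~R - r * c%:~R) ^+ 2.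

Lemma norm_form_places a b c : (norm_form a b c)%:~R = real_place a b c * complex_place a b c.
Proof.
pose e := r ^+ 3 + 4 * r.
have De : e = 1 := root_r.
rewrite /norm_form !(intrD, intrB, intrM, rmorphXn) /=.
transitivity (a%:~R * (a%:~R - 4 * c%:~R) ^+ 2 - 3 * e * (a%:~R * b%:~R * c%:~R)
  + 4 * (a%:~R * b%:~R ^+ 2) + e * b%:~R ^+ 3 + e ^+ 2 * c%:~R ^+ 3
  + 4 * e * (b%:~R * c%:~R ^+ 2) : F).
  by rewrite De; ring.
by rewrite /real_place /complex_place /e; field.
Qed.

Lemma real_place_mulV a b c : real_place a b c = r * real_place (4 * a + b) c a.
Proof.
have De : a%:~R = a%:~R * (r ^+ 3 + 4 * r) by rewrite root_r mulr1.
by rewrite /real_place {1}De intrD intrM; ring.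
Qed.

Lemma norm_form_mulV (R : comPzRingType) (a b c : R) :
  norm_form (4 * a + b) c a = norm_form a b c.
Proof. rewrite /norm_form; ring. Qed.

Lemma real_place_gt1 n a b c : 1 < `|real_place a b c| * 4 ^+ n ->
  exists a' b' c', norm_form a' b' c' = norm_form a b c /\ 1 < `|real_place a' b' c'|.
Proof.
have rge := r_ge; have rle := r_le.
elim: n a b c => [|n IHn] a b c; first by rewrite mulr1; exists a, b, c.
rewrite real_place_mulV -norm_form_mulV exprS => lt1; apply: IHn; apply: lt_le_trans lt1 _.
have r0 : 0 < r by lra.
rewrite mulrA ler_wpM2r ?exprn_ge0 // normrM (gtr0_norm r0).
by have := normr_ge0 (real_place (4 * a + b) c a); move: `|_| => u; nra.
Qed.

Lemma real_place_window n a b c : 1 < `|real_place a b c| <= 4 ^+ n ->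
  exists a' b' c', norm_form a' b' c' = norm_form a b c /\ r < `|real_place a' b' c'| <= 1.
Proof.
have rge := r_ge; have rle := r_le.
elim: n a b c => [|n IHn] a b c /andP[gt1 le1].
  by move: (lt_le_trans gt1 le1); rewrite expr0 ltxx.
have [a' [b' [c' [Da Db Dc]]]] : exists a' b' c' : int,
    [/\ a = 4 * a' + b', b = c' & c = a'].
  by exists c, (a - 4 * c), b; split=> //; ring.
have E : r * real_place a b c = real_place a' b' c' by rewrite [RHS]real_place_mulV -Da -Db -Dc.
have En : norm_form a' b' c' = norm_form a b c by rewrite -norm_form_mulV -Da -Db -Dc.
have r0 : 0 < r by lra.
have En1 : `|real_place a' b' c'| = r * `|real_place a b c| by rewrite -E normrM gtr0_norm.
rewrite -En; case: (lerP `|real_place a' b' c'| 1) => [le_1|gt_1].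
  by exists a', b', c'; split=> //; rewrite le_1 En1 andbT; nra.
apply: IHn; rewrite gt_1 En1 /=; move: le1; rewrite exprS.
by move: `|_| (4 ^+ n) gt1 => u v; nra.
Qed.

Lemma places_window a b c : norm_form a b c != 0 ->
  exists a' b' c', norm_form a' b' c' = norm_form a b c /\ r < `|real_place a' b' c'| <= 1.
Proof.
have arch (x : F) : exists n : nat, x < 4 ^+ n.
  exists (Num.bound `|x|); rewrite (le_lt_trans (ler_norm x)) //.
  apply: lt_trans (archi_boundP (normr_ge0 x)) _.
  by rewrite -natrX ltr_nat ltn_expl.
move=> nz_N; have q1_gt0 : 0 < `|real_place a b c|.
  rewrite normr_gt0; apply: contra_neq nz_N => q1_0; apply/eqP.
  by rewrite -(intr_eq0 F) norm_form_places q1_0 mul0r.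
have [n lt_n] := arch `|real_place a b c|^-1.
have [|a1 [b1 [c1 [<- gt1]]]] := @real_place_gt1 n a b c.
  by rewrite mulrC -ltr_pdivrMr // mul1r.
have [m lt_m] := arch `|real_place a1 b1 c1|.
by apply: (@real_place_window m); rewrite gt1 ltW.
Qed.

(** With u the real conjugate and z a complex conjugate of the element, b and c
    are controlled by the difference u - z, because the terms in a cancel. The
    quadratic inequality |u - z|^2 <= 4/3 |z|^2 + 4 u^2 holds since the right
    side exceeds the left one by |z + 3 u|^2 / 3. *)
Lemma window_small a b c : r < `|real_place a b c| <= 1 -> `|norm_form a b c| = 2 ->
  [/\ c = 0, `|b| <= 1 & `|a| <= 1].
Proof.
have rge := r_ge; have rle := r_le.
move=> /andP[gt_r le1] N2.
have q2_ge0 : 0 <= complex_place a b c.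
  rewrite /complex_place; have r2 := sqr_ge0 r.
  by rewrite addr_ge0 ?sqr_ge0 // mulr_ge0 ?sqr_ge0 //; lra.
have q12 : `|real_place a b c| * complex_place a b c = 2.
  by rewrite -{1}(ger0_norm q2_ge0) -normrM -norm_form_places -intr_norm N2.
have q2_lt : complex_place a b c < 1000 / 123.
  by move: `|_| (complex_place a b c) gt_r le1 q12 q2_ge0 => u v; nra.
have q1_le1 : real_place a b c ^+ 2 <= 1.
  by rewrite -real_normK ?num_real // expr_le1.
have gap : (4 + 3 * r ^+ 2) * ((b%:~R + c%:~R * r / 2) ^+ 2
    + (4 + 3 / 4 * r ^+ 2) * c%:~R ^+ 2) <= 4 / 3 * complex_place a b c + 4 * real_place
      a b c ^+ 2.
  rewrite -subr_ge0.
  have -> : 4 / 3 * complex_place a b c + 4 * real_place a b c ^+ 2 - (4 + 3 * r ^+ 2) *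
      ((b%:~R + c%:~R * r / 2) ^+ 2 + (4 + 3 / 4 * r ^+ 2) * c%:~R ^+ 2)
    = ((a%:~R + 3 * real_place a b c - b%:~R * r / 2 - c%:~R * (4 + r ^+ 2 / 2)) ^+ 2
       + (4 + 3 / 4 * r ^+ 2) * (b%:~R - r * c%:~R) ^+ 2) / 3.
    by rewrite /real_place /complex_place; field.
  apply: mulr_ge0; last by lra.
  apply: addr_ge0; rewrite ?sqr_ge0 //; apply: mulr_ge0; rewrite ?sqr_ge0 //.
  by have := sqr_ge0 r; lra.
have r2 : 15 / 250 <= r ^+ 2 by nra.
(* 4/3 * 1000/123 + 4 < 14.841, and 14.841 / (4 + 3 * 0.06) < 3.551 *)
have gap' : (b%:~R + c%:~R * r / 2) ^+ 2 + (4 + 3 / 4 * r ^+ 2) * c%:~R ^+ 2 < 3551 / 1000 :> F.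
  have := sqr_ge0 (b%:~R + c%:~R * r / 2 : F); have := sqr_ge0 (c%:~R : F).
  move: gap; move: (_ ^+ 2) (_ ^+ 2) (_ ^+ 2) (_ ^+ 2) r2 q1_le1 => u v w s.
  by move: (complex_place a b c) q2_lt => t; nra.
have small_int (n : int) k : n%:~R ^+ 2 < k%:R ^+ 2 :> F -> `|n| < k%:R.
  rewrite -real_normK ?num_real // ltr_pXn2r // ?nnegrE ?ler0n //.
  by rewrite -intr_norm -[k%:R]/(k%:~R) ltr_int natz.
have c0 : c = 0.
  apply: normz_lt1.
  apply: (small_int _ 1%N); have := sqr_ge0 (b%:~R + c%:~R * r / 2 : F).
  move: gap'; rewrite expr1n; have := sqr_ge0 (c%:~R : F).
  by move: (_ ^+ 2) (_ ^+ 2) (_ ^+ 2) r2 => u v w; nra.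
have b1 : `|b| <= 1.
  apply: normz_lt2.
  apply: (small_int _ 2%N); move: gap'; rewrite c0 mul0r mul0r addr0 expr0n mulr0 addr0.
  by lra.
split=> //; apply: normz_lt2.
apply: (small_int _ 2%N).
have : `|b%:~R| <= 1 :> F by rewrite -intr_norm -[1]/(1%:~R) ler_int.
move: le1; rewrite /real_place c0 mul0r addr0 !ler_norml => /andP[+ +] /andP[].
move: (a%:~R) (b%:~R) => u v hu1 hu2 hv1 hv2; clear -rge rle hu1 hu2 hv1 hv2.
have hvr1 : v * r <= 1 / 4 by nra.
have hvr2 : - (1 / 4) <= v * r by nra.
have hu3 : u <= 5 / 4 by lra.
have hu4 : - (5 / 4) <= u by lra.
nra.
Qed.

End RealPlace.

(** Equivalently, the prime ideal of norm 2 is not principal. *)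
Lemma norm_form_neq2 (a b c : int) : `|norm_form a b c| != 2.
Proof.
have E0 (x : realalg) : ('X^3 + 4 *: 'X - 1).[x] = x ^+ 3 + 4 * x - 1 by rewrite !hornerE.
have [||r /andP[r_ge r_le] rt] := @poly_ivt realalg ('X^3 + 4 *: 'X - 1) (123 / 500) (1 / 4).
  by lra.
  by rewrite !E0; apply/andP; split; lra.
have root_r : r ^+ 3 + 4 * r = 1.
  by move: rt; rewrite rootE E0 subr_eq0 => /eqP.
apply/eqP=> N2.
have [|a' [b' [c' [E win]]]] := @places_window _ r root_r r_ge r_le a b c.
  by apply/eqP=> N0; rewrite N0 in N2.
rewrite -E in N2; have [c0 b1 a1] := @window_small _ r root_r r_ge r_le _ _ _ win N2.
move: N2; rewrite c0 {E win c0}.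
have : a' \in [:: -1; 0; 1] by rewrite !inE; lia.
have : b' \in [:: -1; 0; 1] by rewrite !inE; lia.
rewrite !inE => /or3P[] /eqP-> /or3P[] /eqP->; rewrite /norm_form; lia.
Qed.

(** * Weighted factorization in a cancellative monoid *)

(** H is a multiplicative submonoid of the nonzero elements of a field, so that
    divisibility of x by p in H reads H (x / p). *)
Section FactorialMonoid.
Variables (F : fieldType) (H : F -> Prop) (mu : F -> nat).
Hypotheses (H0 : ~ H 0) (H1 : H 1) (HM : forall x y, H x -> H y -> H (x * y)).
Hypothesis mu_gt0 : forall x, H x -> (0 < mu x)%N.
Hypothesis muM : forall x y, H x -> H y -> mu (x * y) = (mu x * mu y)%N.
Hypothesis mu_unit : forall x, H x -> mu x = 1%N -> H x^-1.

Definition monoid_irreducible p :=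
  [/\ H p, ~ H p^-1 & forall a b, H a -> H b -> p = a * b -> H a^-1 \/ H b^-1].

Let nz x : H x -> x != 0.
Proof. by move=> Hx; apply: contra_notN H0 => /eqP <-. Qed.

Lemma monoid_factorization x : H x -> exists s u,
  [/\ {in s, forall p, monoid_irreducible p}, H u, H u^-1 & x = u * \prod_(p <- s) p].
Proof.
have [n] := ssrnat.ubnP (mu x); elim: n x => // n IHn x lt_x Hx.
have [Hx'|nonunit] := EM (H x^-1).
  by exists [::], x; split=> //; rewrite big_nil mulr1.
have [irr_x|] := EM (monoid_irreducible x).
  exists [:: x], 1; split=> //; rewrite ?invr1 //; last by rewrite big_seq1 mul1r.
  by move=> p /[!inE] /eqP->.
move=> red_x.
have [a [b [Ha Hb Dx [nua nub]]]] : exists a b,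
    [/\ H a, H b, x = a * b & ~ H a^-1 /\ ~ H b^-1].
  apply: contra_notP red_x => irr_x; split=> // a b Ha Hb Dx.
  apply: contra_notP irr_x => /not_orP nu; by exists a, b.
have big y : H y -> ~ H y^-1 -> (1 < mu y)%N.
  move=> Hy nuy; have := mu_gt0 Hy; rewrite leq_eqVlt => /orP[/eqP mu1|//].
  by case: nuy; apply: mu_unit.
have [a1 b1] := (big a Ha nua, big b Hb nub).
rewrite ltnS Dx muM // in lt_x.
have [|s [u [irr_s Hu Hu' Da]]] := IHn a _ Ha.
  by apply: leq_trans lt_x; rewrite ltn_Pmulr // mu_gt0.
have [|t [v [irr_t Hv Hv' Db]]] := IHn b _ Hb.
  by apply: leq_trans lt_x; rewrite ltn_Pmull // mu_gt0.
exists (s ++ t), (u * v); split; rewrite ?invfM; try exact: HM.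
  by move=> p; rewrite mem_cat => /orP[/irr_s | /irr_t].
by rewrite Dx Da Db big_cat mulrACA.
Qed.

Hypothesis irreducible_prime : forall p a b, monoid_irreducible p -> H a -> H b ->
  H (a * b / p) -> H (a / p) \/ H (b / p).

Lemma irreducible_dvd_prod p s : monoid_irreducible p -> {in s, forall q, H q} ->
  H ((\prod_(q <- s) q) / p) -> exists2 q, q \in s & H (q / p).
Proof.
move=> irr_p; elim: s => [|q s IHs] Hs; first by rewrite big_nil div1r; case: irr_p.
have Hs' : {in s, forall q, H q} by move=> r sr; apply: Hs; rewrite inE sr orbT.
have Hq : H q by apply: Hs; rewrite mem_head.
have Hprod : H (\prod_(q <- s) q).
  by rewrite big_seq; elim/big_rec: _ => // r x sr Hx; apply: HM => //; apply: Hs'.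
rewrite big_cons => /(irreducible_prime irr_p Hq Hprod) [].
  by exists q; rewrite ?mem_head.
by case/(IHs Hs')=> r sr ?; exists r; rewrite // inE sr orbT.
Qed.

Variable w : F -> nat.
Hypothesis w_unit : forall u x, H u -> H u^-1 -> w (u * x) = w x.

(** If irreducibles are prime, factorizations are unique up to units and order,
    so a weight that does not see units has the same total on both sides. *)
Lemma factorization_weight s t :
    {in s, forall p, monoid_irreducible p} -> {in t, forall p, monoid_irreducible p} ->
    H ((\prod_(p <- s) p) / \prod_(p <- t) p) -> H ((\prod_(p <- t) p) / \prod_(p <- s) p) ->
  (\sum_(p <- s) w p = \sum_(p <- t) w p)%N.
Proof.
elim: s t => [|p s IHs] t irr_s irr_t Hst Hts.
  case: t irr_t {Hts} Hst => [|p t] irr_t; first by [].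
  have [Hp nup _] := irr_t p (mem_head _ _).
  rewrite big_nil big_cons div1r invfM => Hpt; case: nup.
  have Ht : H (\prod_(q <- t) q).
    rewrite big_seq; elim/big_rec: _ => // q x qt Hx; apply: HM => //.
    by have [] := irr_t q; rewrite // inE qt orbT.
  by have := HM Hpt Ht; rewrite mulfVK // nz.
have irr_p := irr_s p (mem_head _ _).
have irr_s' : {in s, forall q, monoid_irreducible q}.
  by move=> q sq; apply: irr_s; rewrite inE sq orbT.
have Hprod l : {in l, forall q, monoid_irreducible q} -> H (\prod_(q <- l) q).
  move=> irr_l; rewrite big_seq; elim/big_rec: _ => // q x ql Hx; apply: HM => //.
  by have [] := irr_l q ql.
have [Hp nup _] := irr_p; have nzp := nz Hp.
have [||q tq Hqp] := irreducible_dvd_prod irr_p (s := t).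
- by move=> q /irr_t[].
- have := HM Hts (Hprod _ irr_s'); rewrite big_cons; congr H.
  move: nzp (nz (Hprod _ irr_s')); move: (\prod_(_ <- _) _) (\prod_(_ <- _) _) => a b *.
  by field; apply/andP.
have [Hq nuq irr_q] := irr_t q tq; have nzq := nz Hq.
have Hpq : H (p / q).
  have [|//|//] := irr_q p (q / p) Hp Hqp; first by rewrite mulrCA divff ?mulr1.
  by rewrite invf_div.
have Dq : w q = w p by rewrite -(divfK nzp q) w_unit // invf_div.
have perm_t := perm_to_rem tq.
rewrite big_cons (perm_big _ perm_t) big_cons /= Dq; congr (_ + _)%N.
have {}irr_t : {in rem q t, forall r, monoid_irreducible r}.
  by move=> r /mem_rem/irr_t.
have Hs := Hprod _ irr_s'; have Ht := Hprod _ irr_t.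
move: Hst Hts; rewrite !big_cons !(perm_big _ perm_t) !big_cons /= => Hst Hts.
apply: IHs => //.
  have := HM Hst Hqp; congr H; rewrite invfM; move: nzp nzq (nz Ht).
  by move: (\prod_(_ <- _) _) (\prod_(_ <- _) _) => a b *; field; apply/and3P.
have := HM Hts Hpq; congr H; rewrite invfM; move: nzp nzq (nz Hs).
by move: (\prod_(_ <- _) _) (\prod_(_ <- _) _) => a b *; field; apply/and3P.
Qed.
End FactorialMonoid.

(** * Power series *)

Section PowerSeriesFacts.
Variable B : comNzRingType.
Implicit Types (f g : fps B) (c : B).

Lemma fps_coefM f g n : fps_coef (f * g) n = \sum_(i < n.+1) fps_coef f i * fps_coef g (n - i).
Proof. by []. Qed.

(** The first n coefficients of the inverse of f, where u inverts the constant
    term. Each coefficient depends on all the preceding ones, so the recursion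
    carries the whole list of them. *)
Fixpoint fps_inv_prefix f u n : seq B :=
  if n is n'.+1 then
    let s := fps_inv_prefix f u n' in
    rcons s (u * ((n' == 0)%:R - \sum_(i < n') s`_i * fps_coef f (n' - i)))
  else [::].

Lemma size_fps_inv_prefix f u n : size (fps_inv_prefix f u n) = n.
Proof. by elim: n => //= n IHn; rewrite size_rcons IHn. Qed.

Lemma nth_fps_inv_prefix f u m i : (i < m)%N ->
  (fps_inv_prefix f u m)`_i = (fps_inv_prefix f u i.+1)`_i.
Proof.
elim: m => // m IHm; rewrite ltnS leq_eqVlt => /orP[/eqP-> //|lt_im].
by rewrite /= nth_rcons size_fps_inv_prefix lt_im IHm.
Qed.

Lemma fps_unit f : is_unit (fps_coef f 0) -> is_unit f.
Proof.
move=> [u fu]; pose g : fps B := FPS (fun n => (fps_inv_prefix f u n.+1)`_n).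
exists g; rewrite mulrC; apply: fpsP => n; rewrite fps_coefM big_ord_recr /= subnn.
rewrite nth_rcons size_fps_inv_prefix ltnn eqxx.
rewrite [_ * fps_coef f 0]mulrC mulrA fu mul1r addrC.
rewrite [X in _ + X](eq_bigr (fun i : 'I_n => (fps_inv_prefix f u n)`_i * fps_coef f (n - i))).
  by rewrite subrK.
by move=> i _; rewrite (@nth_fps_inv_prefix _ _ n).
Qed.

Lemma fps_unit_coef0 f : is_unit f -> is_unit (fps_coef f 0).
Proof.
move=> [g fg]; exists (fps_coef g 0).
have : fps_coef (f * g) 0 = 1 by rewrite fg.
by rewrite fps_coefM big_ord_recl big_ord0 addr0.
Qed.

Definition fpsC c : fps B := FPS (fun n => if n == 0%N then c else 0).
Definition fpsX : fps B := FPS (fun n => (n == 1%N)%:R).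

Lemma fps_coef_mulC c f n : fps_coef (fpsC c * f) n = c * fps_coef f n.
Proof.
rewrite fps_coefM big_ord_recl /= subn0 big1 ?addr0 // => i _.
by rewrite mul0r.
Qed.

Lemma fpsCM c d : fpsC (c * d) = fpsC c * fpsC d.
Proof.
by apply: fpsP => n; rewrite fps_coef_mulC /=; case: eqP; rewrite ?mulr0.
Qed.

Lemma fps_coef_X2 n : fps_coef (fpsX * fpsX) n = (n == 2)%:R.
Proof.
rewrite fps_coefM; case: n => [|n].
  by rewrite big_ord_recl big_ord0 /= mul0r addr0.
rewrite !big_ord_recl /= mul0r add0r mul1r big1 ?addr0; last first.
  by move=> i _; rewrite mul0r.
by rewrite subn1.
Qed.

End PowerSeriesFacts.

(** * The field K and its norm *)

Lemma size_cubic : size ('X^3 + 4 *: 'X - 1 : {poly rat}) = 4%N.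
Proof.
rewrite -addrA size_polyDl size_polyXn //.
rewrite (leq_ltn_trans (size_polyD _ _)) // size_polyN size_poly1 gtn_max andbT.
by rewrite (leq_ltn_trans (size_scale_leq _ _)) // size_polyX.
Qed.

Lemma cubic_irred : irreducible_poly ('X^3 + 4 *: 'X - 1 : {poly rat}).
Proof.
apply: cubic_irreducible; first by rewrite size_cubic.
move=> x; apply/negP; rewrite rootE !hornerE.
rewrite -{1 2}(divq_num_den x).
set n := numq x; set d := denq x => /eqP rt.
have d0 : d%:~R != 0 :> rat by rewrite intr_eq0 denq_neq0.
have E : n ^+ 3 + 4 * n * d ^+ 2 = d ^+ 3 :> int.
  apply/eqP; rewrite -(eqr_int rat) !(intrD, intrM, rmorphXn) /=; apply/eqP.
  move: rt; move: (n%:~R) (d%:~R) d0 => u v v0 /eqP; rewrite subr_eq0 => /eqP rt.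
  by transitivity (v ^+ 3 * ((u / v) ^+ 3 + 4 * (u / v))); [field | rewrite rt mulr1].
have cop : coprimez n d by rewrite coprimezE coprime_num_den.
have d1 : d = 1.
  have : (d %| n ^+ 3)%Z.
    apply/dvdzP; exists (d ^+ 2 - 4 * n * d).
    by apply/(addIr (4 * n * d ^+ 2)); rewrite E; ring.
  rewrite -[n ^+ 3]mulr1 Gauss_dvdzr; last by rewrite coprimez_sym coprimezXl.
  by rewrite dvdz1 => /eqP d1; have := denq_gt0 x; rewrite -/d; lia.
move: E; rewrite d1 !expr1n; nia.
Qed.

Section ZAdjoin.
Variables (K : fieldExtType rat) (alpha : K).

Fact Z_adjoin_subring : subring_closed (Z_adjoin alpha).
Proof.
split=> [|x y|x y]; rewrite ?inE.
- by apply/asboolP; exists 1; rewrite rmorph1 hornerC.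
- by move=> /asboolP[p ->] /asboolP[q ->]; apply/asboolP; exists (p - q);
  rewrite rmorphB /= hornerD hornerN.
- by move=> /asboolP[p ->] /asboolP[q ->]; apply/asboolP; exists (p * q);
  rewrite rmorphM /= hornerM.
Qed.

HB.instance Definition _ :=
  GRing.isSubringClosed.Build K (Z_adjoin alpha) Z_adjoin_subring.

Lemma Z_adjoin_gen : alpha \in Z_adjoin alpha.
Proof. by apply/asboolP; exists 'X; rewrite map_polyX hornerX. Qed.
End ZAdjoin.

(** The form is the norm form of the field with 9 elements, so it is anisotropic
    modulo 3. *)
Lemma dvd3_quadratic (u w k : int) : u ^+ 2 + u * w - w ^+ 2 = 3 * k ->
  exists i j, u = 3 * i /\ w = 3 * j.
Proof.
have res (n : int) : exists i r, n = 3 * i + r /\ (r = 0 \/ r = 1 \/ r = 2).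
  by exists (n %/ 3)%Z, (n %% 3)%Z; lia.
have [i [r [-> r3]]] := res u; have [j [s [-> s3]]] := res w.
move=> E; exists i, j.
have {}E : r ^+ 2 + r * s - s ^+ 2
    = 3 * (k - (3 * i ^+ 2 + 2 * i * r + 3 * i * j + i * s + r * j - 3 * j ^+ 2 - 2 * j * s)).
  by rewrite mulrBr -E; ring.
by move: r3 s3 E => [|[]]-> [|[]]->; lia.
Qed.

Lemma int_mod4 (m : int) : exists q r : int, m = 4 * q + r /\ r \in [:: 0; 1; 2; 3].
Proof. by exists (m %/ 4)%Z, (m %% 4)%Z; split; [|rewrite !inE]; lia. Qed.

Section Field.
Variables (K : fieldExtType rat) (alpha : K).
Hypothesis alpha_root : root ('X^3 + 4 *: 'X - 1 : {poly K}) alpha.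
Hypothesis alpha_gen : <<1; alpha>>%VS = {:K}%VS.

Lemma alpha_cube : alpha ^+ 3 = 1 - 4 * alpha.
Proof.
have : ('X^3 + 4 *: 'X - 1).[alpha] = alpha ^+ 3 + 4 * alpha - 1 by rewrite !hornerE.
by rewrite (rootP alpha_root) => E; apply/eqP; rewrite -subr_eq0 E; apply/eqP; ring.
Qed.

Definition power_basis : 3.-tuple K := [tuple 1; alpha; alpha ^+ 2].

Let ev (q : {poly rat}) : K := (map_poly (in_alg K) q).[alpha].

Let ev_cubic : ev ('X^3 + 4 *: 'X - 1) = 0.
Proof.
rewrite /ev !rmorphB !rmorphD !rmorph1 /= map_polyXn map_polyZ map_polyX /=.
by rewrite !hornerE alpha_cube /= scaler_nat; ring.
Qed.

Lemma power_basis_basis : basis_of {:K} power_basis.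
Proof.
have cubic_neq0 : 'X^3 + 4 *: 'X - 1 != 0 :> {poly rat}.
  exact: irredp_neq0 cubic_irred.
rewrite /basis_of; apply/andP; split.
  rewrite eqEsubv subvf -alpha_gen; apply/subvP=> x /Fadjoin_polyP[p /polyOver1P[q ->] ->].
  pose r := q %% ('X^3 + 4 *: 'X - 1).
  have -> : (map_poly (in_alg K) q).[alpha] = ev r.
    by rewrite {1}(divp_eq q ('X^3 + 4 *: 'X - 1)) -/r rmorphD rmorphM /= hornerD
      hornerM [X in _ * X]ev_cubic mulr0 add0r.
  have size_r : (size r <= 3)%N by rewrite -ltnS -size_cubic ltn_modp.
  rewrite /ev (horner_coef_wide _ (n := 3)) ?size_map_poly //.
  rewrite !big_ord_recl big_ord0 addr0 !coef_map /= !mulr_algl expr1.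
  by rewrite !memvD // memvZ // memv_span // !inE eqxx ?orbT.
apply/freeP=> k; rewrite !big_ord_recl big_ord0 addr0 /= => E i.
pose p : {poly rat} := \poly_(i < 3) k (inord i).
have p_root : ev p = 0.
  rewrite /ev (horner_coef_wide _ (n := 3)) ?size_map_poly ?size_poly //.
  rewrite !big_ord_recl big_ord0 addr0 !coef_map /= !mulr_algl expr0 expr1 !coef_poly /=.
  rewrite -[RHS]E; congr (k _ *: _ + (k _ *: _ + k _ *: _)); apply: val_inj;
  by rewrite /= inordK.
suff p0 : p = 0.
  by have := coef_poly 3 (fun i => k (inord i)) i; rewrite -/p p0 coef0 ltn_ord inord_val.
apply/eqP; apply: contraT => p_neq0.
have : coprimep ('X^3 + 4 *: 'X - 1) p.
  rewrite irreducible_poly_coprime; last exact: cubic_irred.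
  apply: contraL (size_poly 3 (fun i => k (inord i))) => /(dvdp_leq p_neq0).
  by rewrite size_cubic -ltnNge.
case/Bezout_eq1_coprimepP=> [[u v]] /= /(congr1 ev).
rewrite /ev rmorphD !rmorphM rmorph1 /= hornerD !hornerM [X in _ * X]ev_cubic.
by rewrite [X in _ + _ * X]p_root !mulr0 addr0 hornerC => /eqP; rewrite eq_sym oner_eq0.
Qed.

Definition emb (a b c : rat) : K := a%:A + b%:A * alpha + c%:A * alpha ^+ 2.
Definition coor0 := coord power_basis (@Ordinal 3 0 isT).
Definition coor1 := coord power_basis (@Ordinal 3 1 isT).
Definition coor2 := coord power_basis (@Ordinal 3 2 isT).

Lemma emb_coor x : emb (coor0 x) (coor1 x) (coor2 x) = x.
Proof.
rewrite [RHS](coord_basis power_basis_basis (memvf x)).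
rewrite !big_ord_recl big_ord0 addr0 /emb !mulr_algl /= addrA.
congr (_ + _ + _); congr (_ *: _);
  by congr (coord _ _ _); apply: val_inj.
Qed.

Lemma algD (a b : rat) : (a + b)%:A = a%:A + b%:A :> K. Proof. exact: scalerDl. Qed.
Lemma algB (a b : rat) : (a - b)%:A = a%:A - b%:A :> K. Proof. exact: scalerBl. Qed.
Lemma algM (a b : rat) : (a * b)%:A = a%:A * b%:A :> K.
Proof. by rewrite mulr_algl scalerA. Qed.

Lemma coor_emb a b c :
  [/\ coor0 (emb a b c) = a, coor1 (emb a b c) = b & coor2 (emb a b c) = c].
Proof.
have /andP[_ free_b] := power_basis_basis.
pose k (i : 'I_3) : rat := [:: a; b; c]`_i.
have -> : emb a b c = \sum_(i < 3) k i *: power_basis`_i.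
  by rewrite !big_ord_recl big_ord0 addr0 /emb !mulr_algl /= addrA.
split; rewrite [LHS](coord_sum_free _ _ free_b) /k /=; reflexivity.
Qed.

Lemma emb_inj a b c a' b' c' :
  emb a b c = emb a' b' c' -> [/\ a = a', b = b' & c = c'].
Proof.
move=> E; have [Da Db Dc] := coor_emb a b c; have [Da' Db' Dc'] := coor_emb a' b' c'.
by split; [rewrite -Da E | rewrite -Db E | rewrite -Dc E].
Qed.

Lemma embM a b c a' b' c' : emb a b c * emb a' b' c' =
  emb (a * a' + (b * c' + c * b'))
      (a * b' + b * a' - 4 * (b * c' + c * b') + c * c')
      (a * c' + b * b' + c * a' - 4 * (c * c')).
Proof.
have a3 := alpha_cube.
have a4 : alpha ^+ 4 = alpha - 4 * alpha ^+ 2 by rewrite exprS a3; ring.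
have n4 : (4 : rat)%:A = 4 :> K by rewrite scaler_nat.
rewrite /emb !(n4, algM, algB, algD).
transitivity (a%:A * a'%:A + (a%:A * b'%:A + b%:A * a'%:A) * alpha
  + (a%:A * c'%:A + b%:A * b'%:A + c%:A * a'%:A) * alpha ^+ 2
  + (b%:A * c'%:A + c%:A * b'%:A) * alpha ^+ 3 + c%:A * c'%:A * alpha ^+ 4 : K).
  ring.
rewrite a3 a4; ring.
Qed.

(** The field norm of K, from its expression in coordinates. *)
Definition fnorm (x : K) : rat := norm_form (coor0 x) (coor1 x) (coor2 x).

Lemma fnorm_emb a b c : fnorm (emb a b c) = norm_form a b c.
Proof. by rewrite /fnorm; have [-> -> ->] := coor_emb a b c. Qed.

Lemma fnormM x y : fnorm (x * y) = fnorm x * fnorm y.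
Proof.
rewrite -[x]emb_coor -[y]emb_coor embM !fnorm_emb /norm_form; ring.
Qed.

Lemma intr_emb (a b c : int) :
  a%:~R + b%:~R * alpha + c%:~R * alpha ^+ 2 = emb a%:~R b%:~R c%:~R.
Proof. by rewrite /emb !scaler_int. Qed.

Lemma fnorm_intr (a b c : int) :
  fnorm (a%:~R + b%:~R * alpha + c%:~R * alpha ^+ 2) = (norm_form a b c)%:~R.
Proof.
rewrite intr_emb fnorm_emb /norm_form !(intrD, intrB, intrM, rmorphXn) /=; ring.
Qed.

Lemma fnorm1 : fnorm 1 = 1.
Proof.
have -> : 1 = emb 1 0 0 by rewrite /emb scale0r scale1r; ring.
rewrite fnorm_emb /norm_form; ring.
Qed.

Lemma fnorm0 : fnorm 0 = 0.
Proof.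
have -> : 0 = emb 0 0 0 by rewrite /emb scale0r; ring.
rewrite fnorm_emb /norm_form; ring.
Qed.

Lemma fnormN x : fnorm (- x) = - fnorm x.
Proof.
have -> : - x = emb (- 1) 0 0 * x by rewrite /emb scale0r scaleN1r; ring.
by rewrite fnormM fnorm_emb -[RHS]mulN1r; congr (_ * _); rewrite /norm_form; ring.
Qed.

Lemma fnorm_eq0 x : (fnorm x == 0) = (x == 0).
Proof.
apply/eqP/eqP=> [Nx0 | ->]; last exact: fnorm0.
apply/eqP; apply: contraT => /divff/(congr1 fnorm) /eqP.
by rewrite fnormM fnorm1 Nx0 mul0r eq_sym oner_eq0.
Qed.

Lemma fnormV x : fnorm x^-1 = (fnorm x)^-1.
Proof.
have [->|nz_x] := eqVneq x 0; first by rewrite invr0 fnorm0 invr0.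
have nz_N : fnorm x != 0 by rewrite fnorm_eq0.
by apply: (mulfI nz_N); rewrite -fnormM !divff // fnorm1.
Qed.

Lemma Z_adjoinP x :
  reflect (exists a b c : int, x = a%:~R + b%:~R * alpha + c%:~R * alpha ^+ 2)
    (x \in Z_adjoin alpha).
Proof.
apply: (iffP idP) => [/asboolP[p ->] | [a [b [c ->]]]]; last first.
  by rewrite !rpredD ?rpredM ?rpredX ?rpred_int // Z_adjoin_gen.
elim/poly_ind: p => [|p n [a [b [c IHp]]]].
  by exists 0, 0, 0; rewrite rmorph0 horner0 !mulr0z !mul0r !addr0.
exists (c + n), (a - 4 * c), b.
rewrite rmorphD rmorphM /= map_polyX map_polyC /= hornerMXaddC IHp.
have a3 := alpha_cube.
rewrite !(intrD, intrB, intrM).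
transitivity (n%:~R + a%:~R * alpha + b%:~R * alpha ^+ 2 + c%:~R * alpha ^+ 3); first by ring.
by rewrite a3; ring.
Qed.

Lemma fnorm_Z_adjoin x : x \in Z_adjoin alpha -> exists n : nat, `|fnorm x| = n%:R.
Proof.
case/Z_adjoinP=> a [b [c ->]]; exists `|norm_form a b c|%N.
by rewrite fnorm_intr -intr_norm -abszE.
Qed.

Lemma norm_cover_field (x : K) : exists2 t, t \in Z_adjoin alpha &
  `|fnorm (x - t)| < 1 \/ `|fnorm ((1 - alpha) * x - t)| < 1.
Proof.
have [p [q [r lt1]]] := norm_cover (coor0 x) (coor1 x) (coor2 x).
exists (p%:~R + q%:~R * alpha + r%:~R * alpha ^+ 2).
  by apply/Z_adjoinP; exists p, q, r.
case: lt1 => lt1; [left | right]; move: lt1; rewrite intr_emb.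
  congr (`|_| < 1); rewrite -[in RHS](emb_coor x) -fnorm_emb; congr fnorm.
  by rewrite /emb !algB; ring.
congr (`|_| < 1); rewrite -[in RHS](emb_coor x) -fnorm_emb; congr fnorm.
have -> : 1 - alpha = emb 1 (-1) 0 by rewrite /emb scale1r scaleN1r scale0r; ring.
rewrite embM; transitivity (emb (coor0 x - coor2 x) (coor1 x - coor0 x + 4 * coor2 x)
  (coor2 x - coor1 x) - emb p%:~R q%:~R r%:~R).
  by rewrite /emb !algB; ring.
by congr (emb _ _ _ - _); ring.
Qed.

(** * The ideals P and P^2 and the order R *)

(** A generator of A P^-1, where A is the prime ideal of norm 2. *)
Definition theta : K := (1 + alpha) / 3.
(** A generator of P^2. *)
Definition varpi : K := 4 + alpha + 2 * alpha ^+ 2.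
(** The second of the given generators of P; the first one is 3. *)
Definition pgen : K := 2 + 2 * alpha + alpha ^+ 2.

(** The ideal P. Since theta O = A P^-1 with A prime to P, the integers that
    theta multiplies into O are the elements of P. This reduces membership to
    the integrality of coordinates and gives the lower bound on norms in
    [prime_ideal_fnorm]. *)
Definition prime_ideal : {pred K} :=
  [pred x | (x \in Z_adjoin alpha) && (theta * x \in Z_adjoin alpha)].
(** The ideal I = P^2 = varpi O. *)
Definition conductor : {pred K} := [pred x | x / varpi \in Z_adjoin alpha].
Definition orderR : {pred K} := [pred x | `[< exists n : int, x - n%:~R \in conductor >]].

Lemma prime_idealE x : (x \in prime_ideal) =
  (x \in Z_adjoin alpha) && (theta * x \in Z_adjoin alpha).
Proof. by []. Qed.

Lemma conductorE x : (x \in conductor) = (x / varpi \in Z_adjoin alpha).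
Proof. by []. Qed.

Fact prime_ideal_zmod : zmod_closed prime_ideal.
Proof.
split=> [|x y]; rewrite !prime_idealE; first by rewrite mulr0 rpred0.
by case/andP=> Ox Otx /andP[Oy Oty]; rewrite mulrBr !rpredB.
Qed.
HB.instance Definition _ := GRing.isZmodClosed.Build K prime_ideal prime_ideal_zmod.

Fact conductor_zmod : zmod_closed conductor.
Proof.
split=> [|x y]; rewrite !conductorE; first by rewrite mul0r rpred0.
by move=> Ox Oy; rewrite mulrBl rpredB.
Qed.
HB.instance Definition _ := GRing.isZmodClosed.Build K conductor conductor_zmod.

Local Notation "'O" := (Z_adjoin alpha).

(** An identity in K is certified by the quotient by the minimal polynomial of
    alpha; the quotients used below come from polynomial division. *)
Lemma eq_mod_cubic (q x y : K) : x - y = q * (alpha ^+ 3 + 4 * alpha - 1) -> x = y.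
Proof.
by rewrite alpha_cube => E; apply/eqP; rewrite -subr_eq0 E; apply/eqP; ring.
Qed.

Lemma natr_neq0 n : n.+1%:R != 0 :> K.
Proof. by rewrite -scaler_nat scaler_eq0 oner_eq0 orbF pnatr_eq0. Qed.

Lemma theta_sqr : theta ^+ 2 * varpi = 1 - alpha.
Proof.
by apply: (@eq_mod_cubic (2 / 9 * alpha + 5 / 9)); rewrite /theta /varpi; field;
  rewrite ?natr_neq0.
Qed.

Lemma nine_varpi : 9 = varpi * (2 + alpha ^+ 2).
Proof. by apply: (@eq_mod_cubic (-2 * alpha - 1)); rewrite /varpi; ring. Qed.

Lemma pgen3_varpi : 3 * pgen = varpi * (2 - alpha).
Proof. by apply: (@eq_mod_cubic 2); rewrite /varpi /pgen; ring. Qed.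

Lemma pgen2_varpi : pgen ^+ 2 = varpi * (1 + 2 * alpha).
Proof. by apply: (@eq_mod_cubic alpha); rewrite /varpi /pgen; ring. Qed.

Lemma alpha_sqr_varpi : alpha ^+ 2 - 4 * alpha + 2 = varpi * alpha.
Proof. by apply: (@eq_mod_cubic (-2)); rewrite /varpi; ring. Qed.

Lemma theta_varpi : theta * varpi = 2 - alpha + alpha ^+ 2.
Proof.
by apply: (@eq_mod_cubic (2 / 3)); rewrite /theta /varpi; field; rewrite ?natr_neq0.
Qed.

Lemma varpi_gens : varpi = 3 * 3 + pgen * (-2 + alpha - alpha ^+ 2).
Proof. by apply: (@eq_mod_cubic (alpha + 1)); rewrite /pgen /varpi; ring. Qed.

Lemma oneBalpha_dvd4 : (1 - alpha) * (5 + alpha + alpha ^+ 2) = 4.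
Proof. by apply: (@eq_mod_cubic (-1)); ring. Qed.

Lemma theta_inv_gens :
  1 - alpha = theta * (3 * alpha * (1 - alpha) + 2 * (2 * alpha ^+ 2 - 2 * alpha + 1)).
Proof.
by apply: (@eq_mod_cubic (- 1 / 3)); rewrite /theta; field; rewrite ?natr_neq0.
Qed.

Lemma theta_pgen : theta * pgen = 1 + alpha ^+ 2.
Proof.
by apply: (@eq_mod_cubic (1 / 3)); rewrite /theta /pgen; field; rewrite ?natr_neq0.
Qed.

Lemma theta3 : theta * 3 = 1 + alpha.
Proof. by rewrite /theta; field; rewrite ?natr_neq0. Qed.

Let Oalpha : alpha \in 'O := Z_adjoin_gen alpha.

Ltac inO := rewrite ?(rpredD, rpredB, rpredN, rpredM, rpredX, rpred_nat, rpred_int,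
  rpred1, rpred0, Oalpha) //.

Lemma varpi_O : varpi \in 'O. Proof. by rewrite /varpi; inO. Qed.

Lemma fnorm_eq (a b c : int) x :
  x = a%:~R + b%:~R * alpha + c%:~R * alpha ^+ 2 -> fnorm x = (norm_form a b c)%:~R.
Proof. by move=> ->; rewrite fnorm_intr. Qed.

Lemma fnorm_alpha : fnorm alpha = 1.
Proof. by rewrite (@fnorm_eq 0 1 0) //; ring. Qed.

Lemma fnorm_oneBalpha : fnorm (1 - alpha) = 4.
Proof. by rewrite (@fnorm_eq 1 (-1) 0) //; ring. Qed.

Lemma fnorm_varpi : fnorm varpi = 9 * 9.
Proof. by rewrite (@fnorm_eq 4 1 2) //; rewrite /varpi; ring. Qed.

Lemma fnorm_theta : fnorm theta = 2 / 9.
Proof.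
rewrite fnormM fnormV (@fnorm_eq 1 1 0); last by ring.
by rewrite (@fnorm_eq 3 0 0) //; ring.
Qed.

Lemma oneBalpha_neq0 : 1 - alpha != 0.
Proof. by rewrite -fnorm_eq0 fnorm_oneBalpha. Qed.
Lemma varpi_neq0 : varpi != 0.
Proof. by rewrite -fnorm_eq0 fnorm_varpi. Qed.
Lemma theta_neq0 : theta != 0.
Proof. by rewrite -fnorm_eq0 fnorm_theta. Qed.
Lemma alpha_neq0 : alpha != 0.
Proof. by rewrite -fnorm_eq0 fnorm_alpha. Qed.

Lemma prime_ideal_O x : x \in prime_ideal -> x \in 'O. Proof. by case/andP. Qed.

Lemma prime_ideal_ideal x y : x \in 'O -> y \in prime_ideal -> x * y \in prime_ideal.
Proof.
by move=> Ox /andP[Oy Oty]; rewrite prime_idealE mulrCA; apply/andP; split; apply: rpredM.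
Qed.

Lemma conductor_ideal x y : x \in 'O -> y \in conductor -> x * y \in conductor.
Proof. by rewrite !conductorE -mulrA => *; apply: rpredM. Qed.

Lemma three_prime_ideal : 3 \in prime_ideal.
Proof. by rewrite prime_idealE theta3 rpred_nat; inO. Qed.

Lemma pgen_prime_ideal : pgen \in prime_ideal.
Proof. by rewrite prime_idealE theta_pgen /pgen; inO. Qed.

Lemma varpi_prime_ideal : varpi \in prime_ideal.
Proof. by rewrite prime_idealE theta_varpi varpi_O; inO. Qed.

Lemma varpi_cofactor_prime_ideal : - 2 + alpha - alpha ^+ 2 \in prime_ideal.
Proof.
have -> : - 2 + alpha - alpha ^+ 2 = alpha * 3 - pgen by rewrite /pgen; ring.
by apply: rpredB; rewrite ?pgen_prime_ideal // prime_ideal_ideal ?three_prime_ideal.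
Qed.

Lemma conductor_prime_ideal x : x \in conductor -> x \in prime_ideal.
Proof.
rewrite conductorE => Oz; rewrite -(divfK varpi_neq0 x).
exact: prime_ideal_ideal varpi_prime_ideal.
Qed.

Lemma conductor_O x : x \in conductor -> x \in 'O.
Proof. by move/conductor_prime_ideal/prime_ideal_O. Qed.

(** (1 + alpha) x = 3 theta x has coordinates divisible by 3, which determines
    those of x modulo 3. *)
Lemma prime_ideal_gens x : x \in prime_ideal ->
  exists s t, [/\ s \in 'O, t \in 'O & x = 3 * s + pgen * t].
Proof.
case/andP=> /Z_adjoinP[a [b [c Dx]]] /Z_adjoinP[a' [b' [c' Dtx]]].
have E : emb (a%:~R + c%:~R) (a%:~R + b%:~R - 4 * c%:~R) (b%:~R + c%:~R)
    = emb (3 * a'%:~R) (3 * b'%:~R) (3 * c'%:~R).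
  transitivity (3 * (theta * x)).
    have n3 : 3 * theta = 1 + alpha by rewrite mulrC theta3.
    have n4 : (4 : rat)%:A = 4 :> K by rewrite scaler_nat.
    rewrite mulrA n3 Dx /emb !(n4, algM, algB, algD) !scaler_int.
    by apply: (@eq_mod_cubic (- c%:~R)); ring.
  have n3 : (3 : rat)%:A = 3 :> K by rewrite scaler_nat.
  by rewrite Dtx /emb !algM !n3 !scaler_int; ring.
have [Ea _ Eb] := emb_inj E.
have {}Ea : a = 3 * a' - c.
  by apply: (@intr_inj rat); rewrite intrB intrM -Ea; ring.
have {}Eb : b = 3 * c' - c.
  by apply: (@intr_inj rat); rewrite intrB intrM -Eb; ring.
exists ((a' - c)%:~R + (c' - c)%:~R * alpha), c%:~R; split; inO.
by rewrite Dx Ea Eb /pgen !(intrB, intrM); ring.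
Qed.

Lemma prime_ideal_mul x y : x \in prime_ideal -> y \in prime_ideal -> x * y \in conductor.
Proof.
move=> /prime_ideal_gens[s [t [Os Ot ->]]] /prime_ideal_gens[s' [t' [Os' Ot' ->]]].
rewrite conductorE.
have -> : (3 * s + pgen * t) * (3 * s' + pgen * t') =
  9 * (s * s') + 3 * pgen * (s * t' + s' * t) + pgen ^+ 2 * (t * t') by ring.
rewrite {1}nine_varpi pgen3_varpi pgen2_varpi.
have -> : (varpi * (2 + alpha ^+ 2) * (s * s') + varpi * (2 - alpha) * (s * t' + s' * t)
  + varpi * (1 + 2 * alpha) * (t * t')) / varpi = (2 + alpha ^+ 2) * (s * s') +
    (2 - alpha) * (s * t' + s' * t) + (1 + 2 * alpha) * (t * t').
  by field; exact: varpi_neq0.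
by inO.
Qed.

(** The hypothesis gives theta ^+ 2 x in O, that is, (1 - alpha) x is a multiple
    of varpi. Now 1 - alpha divides 4, hence 80, and varpi divides 9, hence 81,
    so x = 81 x - 80 x is a multiple of varpi as well. *)
Lemma prime_ideal_theta_conductor x : x \in 'O -> theta * x \in prime_ideal -> x \in conductor.
Proof.
move=> Ox /andP[_ Oy]; rewrite conductorE.
have v0 := varpi_neq0; have a0 := oneBalpha_neq0.
have -> : x / varpi = 9 * (2 + alpha ^+ 2) * x
    - 20 * (5 + alpha + alpha ^+ 2) * (theta * (theta * x)).
  have -> : theta * (theta * x) = (1 - alpha) * x / varpi.
    by rewrite -theta_sqr; field.
  have -> : 9 * (2 + alpha ^+ 2) * x = 81 * x / varpi.
    have -> : 81 = 9 * 9 :> K by ring.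
    by rewrite {2}nine_varpi; field.
  have -> : 20 * (5 + alpha + alpha ^+ 2) * ((1 - alpha) * x / varpi) = 80 * x / varpi.
    have -> : 80 = 20 * 4 :> K by ring.
    by rewrite -oneBalpha_dvd4; field.
  by field.
by move: (theta * (theta * x)) Oy => y Oy; inO.
Qed.

Lemma emb_intr_inj (a b c a' b' c' : int) :
  a%:~R + b%:~R * alpha + c%:~R * alpha ^+ 2
    = a'%:~R + b'%:~R * alpha + c'%:~R * alpha ^+ 2 :> K ->
  [/\ a = a', b = b' & c = c'].
Proof.
by rewrite !intr_emb => /emb_inj[] /intr_inj-> /intr_inj-> /intr_inj->.
Qed.

Lemma int_prime_ideal (a b : int) : a%:~R + b%:~R * alpha \in prime_ideal ->
  exists i j, a = 3 * i /\ b = 3 * j.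
Proof.
case/andP=> _ /Z_adjoinP[a' [b' [c' E]]].
have : a%:~R + (a + b)%:~R * alpha + b%:~R * alpha ^+ 2
    = (3 * a')%:~R + (3 * b')%:~R * alpha + (3 * c')%:~R * alpha ^+ 2.
  transitivity (3 * (a'%:~R + b'%:~R * alpha + c'%:~R * alpha ^+ 2)).
    by rewrite -E [RHS]mulrA [3 * theta]mulrC theta3 intrD; ring.
  by rewrite !intrM; ring.
by case/emb_intr_inj=> [-> _ ->]; exists a', c'.
Qed.

Lemma int3_prime_ideal (a b : int) : (3 * a)%:~R + (3 * b)%:~R * alpha \in prime_ideal.
Proof.
have -> : (3 * a)%:~R + (3 * b)%:~R * alpha = (a%:~R + b%:~R * alpha) * 3.
  by rewrite !intrM; ring.
by apply: prime_ideal_ideal three_prime_ideal; inO.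
Qed.

Lemma one_notin_prime_ideal : 1 \notin prime_ideal.
Proof.
apply/negP=> P1; have [|i [j [/eqP]]] := @int_prime_ideal 1 0; last by lia.
by rewrite mulr0z mul0r addr0.
Qed.

Lemma prime_ideal_residue x : x \in 'O ->
  exists u w : int, x - (u%:~R + w%:~R * alpha) \in prime_ideal.
Proof.
case/Z_adjoinP=> a [b [c ->]]; exists (a + c), (b + c).
have -> : a%:~R + b%:~R * alpha + c%:~R * alpha ^+ 2 -
    ((a + c)%:~R + (b + c)%:~R * alpha) = c%:~R * (pgen - (1 + alpha) * 3).
  by rewrite !intrD /pgen; ring.
by apply: prime_ideal_ideal;
  rewrite ?rpred_int // rpredB ?pgen_prime_ideal // prime_ideal_ideal ?three_prime_ideal
    //; inO.
Qed.

(** O / P is the field with 9 elements, with basis 1, alpha and alpha ^+ 2 = 1 +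
    alpha; the norm to the field with 3 elements reduces the claim to
    integers. *)
Lemma prime_ideal_prime x y : x \in 'O -> y \in 'O -> x * y \in prime_ideal ->
  x \in prime_ideal \/ y \in prime_ideal.
Proof.
move=> Ox Oy Pxy; have [u [w Pu]] := prime_ideal_residue Ox.
have [u' [w' Pu']] := prime_ideal_residue Oy.
have : (u * u' + w * w')%:~R + (u * w' + w * u' + w * w')%:~R * alpha \in prime_ideal.
  set p := x - _ in Pu; set p' := y - _ in Pu'.
  have -> : (u * u' + w * w')%:~R + (u * w' + w * u' + w * w')%:~R * alpha
     = x * y - (y * p + (u%:~R + w%:~R * alpha) * p'
       + (w * w')%:~R * (pgen - (1 + alpha) * 3)).
    by rewrite /p /p' /pgen !(intrD, intrM); ring.
  have Pg : pgen - (1 + alpha) * 3 \in prime_ideal.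
    by rewrite rpredB ?pgen_prime_ideal // prime_ideal_ideal ?three_prime_ideal //; inO.
  by rewrite rpredB // !rpredD //; apply: prime_ideal_ideal => //; inO.
case/int_prime_ideal=> i [j [Di Dj]].
pose n v z : int := v ^+ 2 + v * z - z ^+ 2.
have [k Dk] : exists k, n u w * n u' w' = 3 * k.
  exists (3 * (i ^+ 2 + i * j - j ^+ 2)).
  transitivity ((u * u' + w * w') ^+ 2 + (u * u' + w * w') * (u * w' + w * u' + w * w')
                - (u * w' + w * u' + w * w') ^+ 2); first by rewrite /n; ring.
  by rewrite Di Dj; ring.
have [[l Dl]|[l Dl]] : (exists l, n u w = 3 * l) \/ (exists l, n u' w' = 3 * l).
  have : (3 %| n u w * n u' w')%Z by rewrite Dk dvdz_mulr.
  rewrite dvdzE abszM Euclid_dvdM // => /orP[]; rewrite -!dvdzE => /dvdzP[l ->];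
  by [left; exists l; rewrite mulrC | right; exists l; rewrite mulrC].
- left; have [a [b [Da Db]]] := dvd3_quadratic Dl.
  by rewrite -(subrK (u%:~R + w%:~R * alpha) x) rpredD // Da Db int3_prime_ideal.
- right; have [a [b [Da Db]]] := dvd3_quadratic Dl.
  by rewrite -(subrK (u'%:~R + w'%:~R * alpha) y) rpredD // Da Db int3_prime_ideal.
Qed.

Lemma theta_conductor x : x \in conductor -> theta * x \in prime_ideal.
Proof.
rewrite conductorE => Oz.
have -> : theta * x = x / varpi * (theta * varpi) by field; exact: varpi_neq0.
apply: prime_ideal_ideal => //; rewrite prime_idealE mulrA -expr2 theta_sqr theta_varpi.
by apply/andP; split; inO.
Qed.

Lemma orderRP x :
  reflect (exists n : int, x - n%:~R \in conductor) (x \in orderR).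
Proof. exact: asboolP. Qed.

Lemma conductor_orderR x : x \in conductor -> x \in orderR.
Proof. by move=> Ix; apply/orderRP; exists 0; rewrite subr0. Qed.

Lemma orderR_O x : x \in orderR -> x \in 'O.
Proof.
by case/orderRP=> n /conductor_O Oxn; rewrite -(subrK n%:~R x) rpredD ?rpred_int.
Qed.

Lemma orderR_subring : subring_closed orderR.
Proof.
split=> [|x y|x y].
- by apply/orderRP; exists 1; rewrite subrr rpred0.
- move=> /orderRP[m Im] /orderRP[n In]; apply/orderRP; exists (m - n).
  have -> : x - y - (m - n)%:~R = x - m%:~R - (y - n%:~R) by rewrite intrB; ring.
  exact: rpredB.
- move=> Rx /orderRP[n In]; have /orderRP[m Im] := Rx.
  apply/orderRP; exists (m * n).
  have -> : x * y - (m * n)%:~R = x * (y - n%:~R) + n%:~R * (x - m%:~R).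
    by rewrite intrM; ring.
  by rewrite rpredD ?conductor_ideal ?rpred_int ?orderR_O.
Qed.

HB.instance Definition _ := GRing.isSubringClosed.Build K orderR orderR_subring.

Lemma int_prime_ideal3 (n : int) : n%:~R \in prime_ideal -> exists m, n = 3 * m.
Proof.
move=> Pn; have [|m [_ [-> _]]] := @int_prime_ideal n 0; last by exists m.
by rewrite mulr0z mul0r addr0.
Qed.

Lemma int9_conductor (n : int) : (9 * n)%:~R \in conductor.
Proof.
have -> : (9 * n)%:~R = n%:~R * (3 * 3) :> K by rewrite intrM; ring.
by apply: conductor_ideal; rewrite ?rpred_int ?prime_ideal_mul ?three_prime_ideal.
Qed.

(** R / I is the ring of rational integers modulo 9, where an element of R
    outside P has a residue n prime to 3; its inverse k modulo 9 gives y
    congruent to k (q y) modulo I. *)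
Lemma orderR_cancel q y : q \in orderR -> q \notin prime_ideal -> y \in 'O ->
  q * y \in orderR -> y \in orderR.
Proof.
move=> /orderRP[n In] notPq Oy /orderRP[m Im].
have cop : coprimez n 9.
  rewrite -[9]/(3 ^+ 2 : int) coprimezXr // coprimez_sym coprimezE prime_coprime //.
  apply: contra notPq => n3; have /dvdzP[k Dn] : (3 %| n)%Z by rewrite dvdzE.
  rewrite -(subrK n%:~R q); apply: rpredD; first exact: conductor_prime_ideal.
  by rewrite Dn intrM prime_ideal_ideal ?rpred_int ?three_prime_ideal.
have [[k l] /= Dkl] := coprimezP _ _ cop.
apply/orderRP; exists (k * m).
have -> : y - (k * m)%:~R = k%:~R * (q * y - m%:~R) - k%:~R * (y * (q - n%:~R))
   + y * (9 * l)%:~R.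
  have E : k%:~R * n%:~R = 1 - 9 * l%:~R :> K.
    by rewrite -intrM; apply: (addIr (l * 9)%:~R); rewrite -intrD Dkl intrM; ring.
  rewrite !intrM; transitivity (y * (1 - 9 * l%:~R) - k%:~R * m%:~R + y * (9 * l%:~R)).
    by ring.
  by rewrite -E; ring.
apply: rpredD; [apply: rpredB|]; apply: conductor_ideal; rewrite ?rpred_int ?int9_conductor //.
exact: conductor_ideal.
Qed.

Lemma three_alpha_notin_orderR : 3 * alpha \notin orderR.
Proof.
apply/negP=> /orderRP[n In].
have [m Dn] : exists m, n = 3 * m.
  apply: int_prime_ideal3; have -> : n%:~R = alpha * 3 - (3 * alpha - n%:~R) by ring.
  apply: rpredB; last exact: conductor_prime_ideal.
  by apply: prime_ideal_ideal; rewrite ?three_prime_ideal.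
have : (1%:~R + 1%:~R * alpha) * ((- m)%:~R + 1%:~R * alpha) \in prime_ideal.
  have -> : (1%:~R + 1%:~R * alpha) * ((- m)%:~R + 1%:~R * alpha)
      = theta * (3 * alpha - n%:~R).
    by rewrite Dn intrM intrN /theta; field; rewrite natr_neq0.
  exact: theta_conductor.
case/prime_ideal_prime=> [||/int_prime_ideal[i [j [_]]]|/int_prime_ideal[i [j [_]]]];
  [by inO | by inO | |];
by lia.
Qed.

(** Since 1 + alpha = 3 theta, the element is theta ^+ 2 (varpi - 9 k), so that
    varpi is not in 9 Z + P^3. *)
Lemma varpi_residue (k : int) :
  theta ^+ 2 * varpi - (1 + alpha) ^+ 2 * k%:~R \notin prime_ideal.
Proof.
rewrite theta_sqr; apply/negP=> Pk.
have : (1 - 2 * k)%:~R + (-1)%:~R * alpha \in prime_ideal.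
  have -> : (1 - 2 * k)%:~R + (-1)%:~R * alpha = 1 - alpha - (1 + alpha) ^+ 2 * k%:~R
      + k%:~R * (pgen - 3).
    by rewrite /pgen intrB intrM; ring.
  by rewrite rpredD // prime_ideal_ideal ?rpred_int // rpredB ?pgen_prime_ideal
    ?three_prime_ideal.
by case/int_prime_ideal=> i [j [_]]; lia.
Qed.

(** O / I has the representatives u + w alpha with u, w modulo 9, and R is the
    set of elements with w = 0. *)
Definition conductor_residue (u w : int) (x : K) := x - (u%:~R + w%:~R * alpha) \in conductor.

Lemma conductor_residue_ex x : x \in 'O -> exists u w : int, conductor_residue u w x.
Proof.
case/Z_adjoinP=> a [b [c ->]]; exists (a - 2 * c), (b + 4 * c); rewrite /conductor_residue.
have -> : a%:~R + b%:~R * alpha + c%:~R * alpha ^+ 2 -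
    ((a - 2 * c)%:~R + (b + 4 * c)%:~R * alpha) = c%:~R * (alpha ^+ 2 - 4 * alpha + 2).
  by rewrite intrB intrD !intrM; ring.
apply: conductor_ideal; rewrite ?rpred_int // conductorE alpha_sqr_varpi.
by rewrite mulrC mulKf ?varpi_neq0.
Qed.

Lemma conductor_residueD (u w i j : int) x : conductor_residue u w x ->
  conductor_residue (u + 9 * i) (w + 9 * j) x.
Proof.
rewrite /conductor_residue => Ix.
have -> : x - ((u + 9 * i)%:~R + (w + 9 * j)%:~R * alpha)
    = x - (u%:~R + w%:~R * alpha) - ((9 * i)%:~R + alpha * (9 * j)%:~R).
  by rewrite !intrD; ring.
rewrite rpredB // rpredD ?int9_conductor //.
by apply: conductor_ideal; rewrite ?int9_conductor.
Qed.

Lemma conductor_residue_mod (u w : int) x : conductor_residue u w x ->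
  conductor_residue (u %% 9)%Z (w %% 9)%Z x.
Proof.
move/(conductor_residueD (- (u %/ 9)%Z) (- (w %/ 9)%Z)).
by congr conductor_residue; rewrite /modz; ring.
Qed.

(** Multiplication by alpha on O / I, where alpha ^+ 2 = 4 alpha - 2. *)
Definition alpha_step (p : int * int) : int * int :=
  (((- 2 * p.2) %% 9)%Z, ((p.1 + 4 * p.2) %% 9)%Z).

Lemma alpha_step_residue (p : int * int) x : conductor_residue p.1 p.2 x ->
  conductor_residue (alpha_step p).1 (alpha_step p).2 (alpha * x).
Proof.
case: p => u w Ix; apply: conductor_residue_mod; move: Ix; rewrite /conductor_residue /= => Ix.
have -> : alpha * x - ((- 2 * w)%:~R + (u + 4 * w)%:~R * alpha) =
    alpha * (x - (u%:~R + w%:~R * alpha)) + w%:~R * (alpha ^+ 2 - 4 * alpha + 2).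
  by rewrite intrD !intrM; ring.
rewrite rpredD ?conductor_ideal ?rpred_int // conductorE alpha_sqr_varpi.
by rewrite mulrC mulKf ?varpi_neq0.
Qed.

(** Twelve powers suffice because this is the order of the unit group of O / I
    modulo that of the rational integers modulo 9, namely 72 / 6. *)
Lemma alpha_step_hits : all (fun u => all (fun w =>
    has (fun j => (iter j alpha_step (Posz u, Posz w)).2 == 0) (iota 0 12))
  (iota 0 9)) (iota 0 9).
Proof. by vm_compute. Qed.

(** The powers of the unit alpha act on the 81 residues modulo I, and every
    orbit meets the residues of rational integers. *)
Lemma unit_mul_orderR x : x \in 'O -> exists j, alpha ^+ j * x \in orderR.
Proof.
move=> /conductor_residue_ex[u [w /conductor_residue_mod Ix]].
have small (n : int) : exists2 k, k \in iota 0 9 & (n %% 9)%Z = Posz k.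
  have n0 := modz_ge0 n (isT : 9 != 0 :> int).
  have n9 := @ltz_pmod n 9 isT.
  exists `|(n %% 9)%Z|%N; last by rewrite gez0_abs.
  by rewrite mem_iota /= add0n -ltz_nat gez0_abs.
have [[k Hk Dk] [l Hl Dl]] := (small u, small w).
have /hasP[j _ /eqP hit] := allP (allP alpha_step_hits k Hk) l Hl.
exists j; rewrite Dk Dl in Ix.
have: conductor_residue (iter j alpha_step (Posz k, Posz l)).1
    (iter j alpha_step (Posz k, Posz l)).2 (alpha ^+ j * x).
  elim: (j) => [|i IHi]; first by rewrite expr0 mul1r.
  by rewrite iterS exprS -mulrA; apply: alpha_step_residue.
rewrite hit /conductor_residue mulr0z mul0r addr0 => Ij.
by apply/orderRP; eexists; exact: Ij.
Qed.

(** * Class number two *)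

(** Fractional ideals are the bounded O-submodules of K; here boundedness is
    having a common denominator. *)
Record Omodule (J : K -> Prop) : Prop := {
  omodD : forall x y, J x -> J y -> J (x + y);
  omodM : forall a x, a \in 'O -> J x -> J (a * x) }.

Definition Obounded (J : K -> Prop) :=
  exists2 D : K, D != 0 & forall x, J x -> D * x \in 'O.

Lemma omodB (J : K -> Prop) x y : Omodule J -> J x -> J y -> J (x - y).
Proof.
move=> modJ Jx Jy; rewrite -[- y]mulN1r; apply: (omodD modJ) => //.
by apply: (omodM modJ); inO.
Qed.

Lemma min_norm (J : K -> Prop) a : Omodule J -> Obounded J -> J a -> a != 0 ->
  exists d, [/\ J d, d != 0 & forall y, J y -> y != 0 -> `|fnorm d| <= `|fnorm y|].
Proof.
move=> modJ [D nzD bndJ] Ja nza.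
pose Q (n : nat) := `[< exists d, [/\ J d, d != 0 & `|fnorm (D * d)| = n%:R] >].
have exQ : exists n, Q n.
  have [n Dn] := fnorm_Z_adjoin (bndJ _ Ja).
  by exists n; apply/asboolP; exists a.
case: (ex_minnP exQ) => n /asboolP[d [Jd nzd Dn]] min_n.
exists d; split=> // y Jy nzy.
have [m Dm] := fnorm_Z_adjoin (bndJ _ Jy).
have : (n <= m)%N by apply: min_n; apply/asboolP; exists y.
rewrite -(ler_nat rat) -Dn -Dm !fnormM !normrM ler_pM2l //.
by rewrite normr_gt0 fnorm_eq0.
Qed.

(** Suppose y / d is not an integer. The minimality of d excludes that y / d has
    an integer within norm distance 1, so by the covering (1 - alpha) y / d has
    such an integer t, and by minimality (1 - alpha) y = t d. Modulo 1 - alpha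
    the number t is one of 0, 1, 2, 3. The class 0 makes y / d an integer, and 1
    and 3 put d / (1 - alpha), of a quarter of the norm of d, into J. *)
Lemma min_norm_generates (J : K -> Prop) d : Omodule J -> J d -> d != 0 ->
    (forall y, J y -> y != 0 -> `|fnorm d| <= `|fnorm y|) ->
  (forall y, J y -> y / d \in 'O) \/ J (2 * d / (1 - alpha)).
Proof.
move=> modJ Jd nzd min_d; have nzb := oneBalpha_neq0.
have small y : J y -> `|fnorm (y / d)| < 1 -> y = 0.
  move=> Jy lt1; apply/eqP; apply: contraLR lt1 => nzy; rewrite -leNgt.
  by rewrite fnormM fnormV normrM normfV ler_pdivlMr ?normr_gt0 ?fnorm_eq0 // mul1r min_d.
have Nb : fnorm (1 - alpha) = 4 := fnorm_oneBalpha.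
have notJ : ~ J (d / (1 - alpha)).
  move=> Jb; have := small _ Jb.
  have -> : d / (1 - alpha) / d = (1 - alpha)^-1 by field; rewrite nzd nzb.
  have lt1 : `|4^-1| < 1 :> rat by rewrite normfV normr_nat invf_lt1 ?ltr1n.
  rewrite fnormV Nb => /(_ lt1) /eqP.
  by rewrite mulf_eq0 invr_eq0 (negPf nzd) (negPf nzb).
have [all_y|] := EM (forall y, J y -> y / d \in 'O); first by left.
move/existsNP=> [y /not_implyP[Jy /negP notOy]]; right.
have [t Ot [lt1|lt1]] := norm_cover_field (y / d).
  have := small (y - t * d); rewrite mulrBl mulfK // => /(_ _ lt1).
  have Jtd : J (t * d) := omodM modJ Ot Jd.
  by move=> /(_ (omodB modJ Jy Jtd))/subr0_eq Dy; rewrite Dy mulfK ?Ot in notOy.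
have Ob : 1 - alpha \in 'O by inO.
have Dt : (1 - alpha) * y = t * d.
  have := small ((1 - alpha) * y - t * d).
  have -> : ((1 - alpha) * y - t * d) / d = (1 - alpha) * (y / d) - t by field.
  move=> /(_ _ lt1) H.
  by apply: subr0_eq; apply: H; apply: omodB => //; apply: omodM.
have [m [w [Ow Dtw]]] : exists m w, w \in 'O /\ t = m%:~R + (1 - alpha) * w.
  have [a [b [c ->]]] := Z_adjoinP _ Ot.
  exists (a + b + c), (- (b%:~R + c%:~R * (1 + alpha))); split; first by inO.
  by rewrite !intrD; ring.
have [q [r [Dm r4]]] : exists q r : int, m = 4 * q + r /\ r \in [:: 0; 1; 2; 3].
  exact: int_mod4.
pose w' := q%:~R * (5 + alpha + alpha ^+ 2) + w.
have Ow' : w' \in 'O by rewrite /w'; inO.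
have Dy : r%:~R * d = (1 - alpha) * (y - w' * d).
  rewrite mulrBr Dt Dtw /w' Dm intrD intrM.
  transitivity ((4 * q%:~R + r%:~R) * d - (1 - alpha) * (5 + alpha + alpha ^+ 2) * q%:~R * d).
    by rewrite oneBalpha_dvd4; ring.
  by ring.
have Jyw : J (y - w' * d) by apply: omodB => //; apply: omodM.
have Dyw : y - w' * d = r%:~R * d / (1 - alpha) by rewrite Dy; field.
move: r4; rewrite !inE => /or4P[] /eqP Dr; rewrite Dr in Dyw.
- move: Dyw; rewrite mulr0z !mul0r => /subr0_eq Dyw.
  by rewrite Dyw mulfK ?Ow' in notOy.
- by rewrite Dyw mulr1z mul1r in Jyw.
- by rewrite Dyw in Jyw.
- case: notJ; have -> : d / (1 - alpha) = (5 + alpha + alpha ^+ 2) * d - (y - w' * d).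
    apply: (mulfI nzb);
      rewrite [RHS]mulrBr [X in _ = X - _]mulrA oneBalpha_dvd4 Dyw -[3%:~R]/(3 : K).
    by field.
  by apply: omodB => //; apply: omodM => //; inO.
Qed.

(** The product of P and J; two terms suffice as P has two generators. *)
Definition prime_ideal_span (J : K -> Prop) (x : K) : Prop :=
  exists y z, [/\ J y, J z & x = 3 * y + pgen * z].

Lemma prime_ideal_span_mod J : Omodule J -> Omodule (prime_ideal_span J).
Proof.
move=> modJ; split=> [_ _ [y [z [Jy Jz ->]]] [y' [z' [Jy' Jz' ->]]] | a _ Oa [y [z [Jy Jz
  ->]]]].
  by exists (y + y'), (z + z'); split; [exact: (omodD modJ) | exact: (omodD modJ) | ring].
by exists (a * y), (a * z); split; [exact: (omodM modJ) | exact: (omodM modJ) | ring].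
Qed.

Lemma prime_ideal_spanM J p y : Omodule J -> p \in prime_ideal -> J y -> prime_ideal_span
  J (p * y).
Proof.
move=> modJ /prime_ideal_gens[s [t [Os Ot ->]]] Jy.
by exists (s * y), (t * y); split; [exact: (omodM modJ) | exact: (omodM modJ) | ring].
Qed.

Lemma prime_ideal_span_mul J p x : Omodule J -> p \in prime_ideal -> prime_ideal_span J x
  -> J (p * x / varpi).
Proof.
move=> modJ Pp [y [z [Jy Jz ->]]]; have nzv := varpi_neq0.
have -> : p * (3 * y + pgen * z) / varpi = (p * 3) / varpi * y + (p * pgen) / varpi * z.
  by field.
by apply: (omodD modJ); apply: (omodM modJ) => //; rewrite -conductorE prime_ideal_mul
  ?three_prime_ideal ?pgen_prime_ideal.
Qed.

Lemma prime_ideal_span_bounded J : Obounded J -> Obounded (prime_ideal_span J).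
Proof.
move=> [D nzD bndJ]; exists D => // _ [y [z [/bndJ OJy /bndJ OJz ->]]].
by rewrite mulrDr !(mulrCA D); apply: rpredD; apply: rpredM => //; rewrite /pgen; inO.
Qed.

(** d and 2 d / (1 - alpha) span d A^-1, where A = (2, 1 - alpha), and theta^-1
    O = P A^-1. *)
Lemma theta_inv_span J d : Omodule J -> J d -> J (2 * d / (1 - alpha)) ->
  prime_ideal_span J (theta^-1 * d).
Proof.
move=> modJ Jd J2d; have nzb := oneBalpha_neq0; have nzt := theta_neq0.
have -> : theta^-1 * d = (alpha * 3) * d
    + (2 * alpha ^+ 2 - 2 * alpha + 1) * (2 * d / (1 - alpha)).
  have -> : theta^-1 =
      (3 * alpha * (1 - alpha) + 2 * (2 * alpha ^+ 2 - 2 * alpha + 1)) / (1 - alpha).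
    by apply: (mulfI nzt); rewrite divff // mulrA -theta_inv_gens divff.
  by field.
apply: (omodD (prime_ideal_span_mod modJ)); apply: prime_ideal_spanM => //.
  by apply: prime_ideal_ideal; rewrite ?three_prime_ideal.
have -> : 2 * alpha ^+ 2 - 2 * alpha + 1 = 2 * pgen - (1 + 2 * alpha) * 3.
  by rewrite /pgen; ring.
by apply: rpredB; apply: prime_ideal_ideal;
  rewrite ?three_prime_ideal ?pgen_prime_ideal //; inO.
Qed.

(** Let d0 and d1 be elements of minimal norm in J and in J P. If one of them is
    a generator, then J is a multiple of O or of P, as P^2 is principal.
    Otherwise theta^-1 d0 lies in J P and theta^-1 d1 / varpi lies in J.
    Comparing norms, |N d1| <= 9/2 |N d0| and |N d0| <= 1/18 |N d1|, which is
    absurd. *)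
Lemma class_number_two J a : Omodule J -> Obounded J -> J a -> a != 0 ->
  exists2 d, d != 0 &
    (forall x, J x <-> x / d \in 'O) \/ (forall x, J x <-> x / d \in prime_ideal).
Proof.
move=> modJ bndJ Ja nza; have nzv := varpi_neq0; have nzt := theta_neq0.
have modJP := prime_ideal_span_mod modJ; have bndJP := prime_ideal_span_bounded bndJ.
have [d0 [Jd0 nzd0 min0]] := min_norm modJ bndJ Ja nza.
have nz3 : 3 != 0 :> K := natr_neq0 2.
have [d1 [Jd1 nzd1 min1]] := min_norm modJP bndJP (prime_ideal_spanM modJ
  three_prime_ideal Ja) (mulf_neq0 nz3 nza).
have [gen0|J2d0] := min_norm_generates modJ Jd0 nzd0 min0.
  exists d0 => //; left=> x; split=> [|Ox]; first exact: gen0.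
  by rewrite -(divfK nzd0 x); apply: (omodM modJ).
have [gen1|J2d1] := min_norm_generates modJP Jd1 nzd1 min1.
  exists (d1 / varpi); first by rewrite mulf_neq0 ?invr_eq0.
  right=> x; rewrite invf_div mulrA; split=> [Jx|Px].
    have -> : x * varpi / d1 =
       3 * x / d1 * 3 + pgen * x / d1 * (- 2 + alpha - alpha ^+ 2).
      by rewrite varpi_gens; field.
    by apply: rpredD; apply: prime_ideal_ideal;
      rewrite ?three_prime_ideal ?varpi_cofactor_prime_ideal //; apply: gen1;
      apply: prime_ideal_spanM => //; rewrite ?three_prime_ideal ?pgen_prime_ideal.
  have := prime_ideal_span_mul modJ Px Jd1.
  by have -> // : x * varpi / d1 * d1 / varpi = x by field; rewrite nzd1 nzv.
exfalso; have nz0 x : x != 0 -> 0 < `|fnorm x| by rewrite normr_gt0 fnorm_eq0.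
have Nt : fnorm theta^-1 = 9 / 2 by rewrite fnormV fnorm_theta invf_div.
have Nt' : `|fnorm theta^-1| = 9 / 2.
  by rewrite Nt normrM normfV !normr_nat.
have Nv : `|fnorm varpi^-1| = (9 * 9)^-1.
  have ge0 : 0 <= (9 * 9)^-1 :> rat by rewrite invr_ge0 mulr_ge0 ?ler0n.
  by rewrite fnormV fnorm_varpi (ger0_norm ge0).
have le1 : `|fnorm d1| <= 9 / 2 * `|fnorm d0|.
  have nz : theta^-1 * d0 != 0 by rewrite mulf_neq0 ?invr_eq0.
  have := min1 _ (theta_inv_span modJ Jd0 J2d0) nz.
  by rewrite fnormM normrM Nt'.
have le0 : `|fnorm d0| <= 9 / 2 * `|fnorm d1| / (9 * 9).
  have nz : theta^-1 * d1 / varpi != 0 by rewrite !mulf_neq0 ?invr_eq0.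
  have Jt : J (theta^-1 * d1 / varpi).
    have [y [z [Jy Jz ->]]] := theta_inv_span modJP Jd1 J2d1; rewrite mulrDl.
    by apply: (omodD modJ); apply: prime_ideal_span_mul;
      rewrite ?three_prime_ideal ?pgen_prime_ideal.
  have := min0 _ Jt nz.
  by rewrite fnormM (fnormM theta^-1) 2!normrM Nt' Nv.
have := nz0 _ nzd0; move: le1 le0.
by move: `|fnorm d0| `|fnorm d1| => u v; lra.
Qed.

Lemma fnorm_int_neq2 z : z \in 'O -> exists k : int, fnorm z = k%:~R /\ `|k| != 2.
Proof.
case/Z_adjoinP=> a [b [c ->]]; exists (norm_form a b c).
by rewrite fnorm_intr norm_form_neq2.
Qed.

(** Both x and theta x are integers, and N theta = 2 / 9; the last claim is that
    theta x does not have norm 2 or -2. *)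
Lemma prime_ideal_fnorm x : x \in prime_ideal ->
  exists k : int, [/\ fnorm (theta * x) = (2 * k)%:~R, fnorm x = (9 * k)%:~R & `|k| != 1].
Proof.
case/andP=> /fnorm_int_neq2[m [Dm _]] /fnorm_int_neq2[n [Dn n2]].
have E : 9 * n = 2 * m.
  apply: (@intr_inj rat); rewrite !intrM -Dn -Dm fnormM fnorm_theta.
  by move: (fnorm x) => u; field.
have [k Dk] : exists k, n = 2 * k by clear -E; exists (m - 4 * n); lia.
exists k; rewrite Dm Dn Dk; split=> //; first by congr (_%:~R); clear -E Dk; lia.
by clear -n2 Dk; lia.
Qed.

(** The product of theta x and theta y would be theta ^+ 2 varpi = 1 - alpha, of norm
    4, but their norms are even and different from 2 and -2. This says that P is not
    principal: varpi would be the product of a generator and another element. *)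
Lemma not_principal x y : x \in prime_ideal -> y \in prime_ideal -> x * y <> varpi.
Proof.
move=> /prime_ideal_fnorm[k [Dk _ k1]] /prime_ideal_fnorm[l [Dl _ l1]] Dxy.
have : fnorm (theta * x) * fnorm (theta * y) = 4.
  by rewrite -fnormM mulrACA Dxy -expr2 theta_sqr fnorm_oneBalpha.
rewrite Dk Dl -intrM -[4]/(4%:~R) => /intr_inj; clear -k1 l1.
by nia.
Qed.

(** The product y of the other two conjugates of x is an integer with x y = N
    x. *)
Lemma fnorm_unit x : x \in 'O -> `|fnorm x| = 1 -> x^-1 \in 'O.
Proof.
case/Z_adjoinP=> a [b [c Dx]] N1.
pose y : K := ((a - 4 * c) ^+ 2 - b * (c - 4 * b))%:~R
  + ((c - 4 * b) * c - (a - 4 * c) * b)%:~R * alpha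
  + (b ^+ 2 - c * (a - 4 * c))%:~R * alpha ^+ 2.
have Oy : y \in 'O by rewrite /y; inO.
have Dxy : x * y = (norm_form a b c)%:~R.
  apply: (@eq_mod_cubic ((b ^+ 2 - c * (a - 4 * c))%:~R * (c%:~R * alpha + b%:~R)
    + ((c - 4 * b) * c - (a - 4 * c) * b)%:~R * c%:~R)).
  by rewrite Dx /y /norm_form !(intrD, intrB, intrM, rmorphXn) /=; ring.
have {}N1 : `|norm_form a b c| = 1.
  by apply: (@intr_inj rat); rewrite intr_norm -fnorm_intr -Dx.
have x0 : x != 0 by rewrite -fnorm_eq0 Dx fnorm_intr intr_eq0; apply: contra_eq_neq N1 => ->.
have -> : x^-1 = y * (norm_form a b c)%:~R.
  apply: (mulfI x0); rewrite divff // mulrA Dxy -intrM.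
  have -> // : norm_form a b c * norm_form a b c = 1.
  by rewrite -expr2 -real_normK ?num_real // N1 expr1n.
by rewrite rpredM ?rpred_int.
Qed.

(** * The ring of integers *)

Lemma clear_denominators x : exists2 b : int, b != 0 & b%:~R * x \in 'O.
Proof.
rewrite -(emb_coor x); set a := coor0 _; set b := coor1 _; set c := coor2 _.
exists (denq a * denq b * denq c); first by rewrite !mulf_neq0 ?denq_neq0.
have E (q : rat) : (denq q)%:~R * q%:A = (numq q)%:~R :> K.
  by rewrite -!scaler_int -scalerAl mul1r scalerA numqE [_ * q]mulrC.
have -> : (denq a * denq b * denq c)%:~R * emb a b c =
  (denq b * denq c)%:~R * (numq a)%:~R + (denq a * denq c)%:~R * (numq b)%:~R * alpha
  + (denq a * denq b)%:~R * (numq c)%:~R * alpha ^+ 2.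
  by rewrite -!E /emb !intrM; ring.
by inO.
Qed.

(** If x is integral, then O[x] is a fractional ideal as well as a ring, so it
    is e O or e P. In the first case e ^+ 2 is in e O, so e is an integer and e
    O is contained in O. In the second case e P P is contained in P and 1 is in
    e P; so e^-1 and e varpi are elements of P with product varpi, which is
    impossible. *)
Lemma integral_closure x : integralOver (intr : int -> K) x -> x \in 'O.
Proof.
case=> p mon_p rt; have [b nzb Obx] := clear_denominators x.
have nzb' : b%:~R != 0 :> K by rewrite -scaler_int scaler_eq0 oner_eq0 orbF intr_eq0.
pose d := (size p).-1; pose D : K := b%:~R ^+ d.
have Dx n : D * x ^+ n \in 'O.
  elim/ltn_ind: n => n IHn; case: (leqP n d) => [le_nd|lt_dn].
    have -> : D * x ^+ n = b%:~R ^+ (d - n) * (b%:~R * x) ^+ n.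
      by rewrite exprMn mulrA -exprD subnK.
    by rewrite rpredM // rpredX // rpred_int.
  have -> : x ^+ n = x ^+ (n - d) * x ^+ d by rewrite -exprD subnK // ltnW.
  have -> : x ^+ d = - \sum_(i < d) (p`_i)%:~R * x ^+ i.
    have := rootP rt; rewrite (horner_coef_wide _ (n := d.+1)); last first.
      by rewrite (leq_trans (size_poly _ _)) // /d; case: (size p).
    have lead1 : p`_d = 1 := monicP mon_p.
    rewrite big_ord_recr /= coef_map /= lead1 mulr1z mul1r => /eqP.
    rewrite addrC addr_eq0 => /eqP->; congr (- _); apply: eq_bigr => i _.
    by rewrite coef_map.
  rewrite !mulrN rpredN mulr_sumr mulr_sumr rpred_sum // => i _.
  have -> : D * (x ^+ (n - d) * ((p`_i)%:~R * x ^+ i)) = (p`_i)%:~R * (D * x ^+ (n - d + i)).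
    by rewrite exprD; ring.
  rewrite rpredM ?rpred_int //; apply: IHn.
  by rewrite -ltn_subRL subKn ?ltn_ord // ltnW.
pose J (y : K) := exists2 q, q \is a polyOver 'O & y = q.[x].
have modJ : Omodule J.
  split=> [_ _ [q Oq ->] [r Or ->] | a _ Oa [q Oq ->]].
    by exists (q + r); rewrite ?rpredD ?hornerD.
  by exists (a%:P * q); rewrite ?rpredM ?polyOverC // hornerM hornerC.
have bndJ : Obounded J.
  exists D; first by rewrite expf_neq0.
  move=> _ [q /polyOverP Oq ->]; rewrite horner_coef mulr_sumr rpred_sum // => i _.
  by rewrite mulrCA; apply: rpredM; [exact: Oq | exact: Dx].
have J1 : J 1 by exists 1; rewrite ?rpred1 ?hornerC.
have Jx : J x by exists 'X; rewrite ?polyOverX ?hornerX.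
have JM y z : J y -> J z -> J (y * z).
  by move=> [q Oq ->] [r Or ->]; exists (q * r); rewrite ?rpredM ?hornerM.
have [e nze [genJ|genJ]] := class_number_two modJ bndJ J1 (oner_neq0 K).
  have Je : J e by apply/genJ; rewrite divff ?rpred1.
  have Oe : e \in 'O by have /genJ := JM _ _ Je Je; rewrite mulfK.
  by move/genJ: Jx => Oxe; rewrite -(divfK nze x) rpredM.
have Pe : e^-1 \in prime_ideal by move/genJ: J1; rewrite mul1r.
have JP y : y \in prime_ideal -> J (e * y) by move=> Py; apply/genJ; rewrite mulrC mulKf.
have PP y z : y \in prime_ideal -> z \in prime_ideal -> e * (y * z) \in prime_ideal.
  move=> Py Pz; have /genJ := JM _ _ (JP _ Py) (JP _ Pz).
  by have -> : e * y * (e * z) / e = e * (y * z) by field.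
case: (@not_principal e^-1 (e * varpi)) => //; last by rewrite mulKf.
by rewrite varpi_gens mulrDr rpredD ?PP ?three_prime_ideal ?pgen_prime_ideal
  ?varpi_cofactor_prime_ideal.
Qed.

Lemma ring_of_integersE : ring_of_integers K =i 'O.
Proof.
move=> x; apply/idP/idP => [/asboolP/integral_closure // | /asboolP[p ->]].
apply/asboolP; apply: integral_horner.
  by apply/integral_poly => i; rewrite coef_map; apply: integral_id.
exists ('X^3 + 4 *: 'X - 1).
  rewrite monicE -addrA lead_coefDl ?lead_coefXn // size_polyXn.
  rewrite (leq_ltn_trans (size_polyD _ _)) // size_polyN size_poly1 gtn_max andbT.
  by rewrite (leq_ltn_trans (size_scale_leq _ _)) // size_polyX.
by rewrite rmorphB rmorphD /= map_polyXn map_polyZ map_polyX rmorph1.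
Qed.

(** The square root s would give the integer theta s, of norm 2 or -2, whose
    square is 1 - alpha. *)
Lemma varpi_nonsquare s : s ^+ 2 <> varpi.
Proof.
move=> Ds; have Dts : (theta * s) ^+ 2 = 1 - alpha by rewrite exprMn Ds theta_sqr.
have Ots : theta * s \in 'O.
  apply: integral_closure; apply: (@integral_root_monic _ _ _ _ ('X^2 - (1 - alpha)%:P)).
  - by rewrite monicXnsubC.
  - by rewrite rootE !hornerE Dts subrr.
  apply/integral_poly => i; rewrite coefB coefXn coefC.
  have intO y : y \in 'O -> integralOver (intr : int -> K) y.
    by rewrite -ring_of_integersE => /asboolP.
  by apply: intO; apply: rpredB; case: eqP => _; inO.
have [k [Dk /eqP k2]] := fnorm_int_neq2 Ots; apply: k2.
have : fnorm ((theta * s) ^+ 2) = 4 by rewrite Dts fnorm_oneBalpha.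
rewrite expr2 fnormM Dk -intrM -[4]/(4%:~R) => /intr_inj; clear; nia.
Qed.

(** * The monoid of ideals *)

(** The square of every ideal of O is principal, and an ideal is determined by
    its square. So ideals are represented by the generators of their squares: x
    O with x in O by x ^+ 2, and x P^-1 with x in P by x ^+ 2 / varpi. Products
    of ideals become products in K, and two representatives of an ideal differ
    by the square of a unit. *)
Definition divisor (z : K) : Prop := z != 0 /\
  ((exists2 x, x \in 'O & z = x ^+ 2) \/ (exists2 x, x \in prime_ideal & z = x ^+ 2 / varpi)).

(** The two kinds of representatives do not overlap, because varpi is not a
    square. *)
Lemma divisor_sqr d : d != 0 -> divisor (d ^+ 2) <-> d \in 'O.
Proof.
move=> nzd; have nzv := varpi_neq0.
split=> [[_ [] [x Ox /eqP]] | Od]; last by split; [rewrite expf_neq0 | left; exists d].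
  by rewrite eqf_sqr => /orP[] /eqP->; rewrite ?rpredN.
move=> /eqP Dd; case: (@varpi_nonsquare (x / d)).
by rewrite exprMn exprVn Dd; field; rewrite nzv; move: nzd;
  rewrite -sqrf_eq0 Dd mulf_eq0 negb_or sqrf_eq0 => /andP[->].
Qed.

Lemma divisor_varpi d : d != 0 -> divisor (d ^+ 2 * varpi) <-> d * varpi \in prime_ideal.
Proof.
move=> nzd; have nzv := varpi_neq0.
split=> [[_ [] [x Ox /eqP Dx]] | Pd].
- case: (@varpi_nonsquare (x / d)).
  by rewrite exprMn exprVn -(eqP Dx); field.
- have : (d * varpi) ^+ 2 == x ^+ 2.
    by rewrite exprMn expr2 -[varpi ^+ 2]/(varpi * varpi) -expr2 mulrA (eqP Dx) divfK.
  by rewrite eqf_sqr => /orP[] /eqP->; rewrite ?rpredN.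
split; first by rewrite mulf_neq0 ?expf_neq0.
by right; exists (d * varpi) => //; field.
Qed.

Lemma divisor1 : divisor 1.
Proof. by split; [rewrite oner_neq0 | left; exists 1; rewrite ?rpred1 ?expr1n]. Qed.

Lemma divisor0 : ~ divisor 0.
Proof. by case; rewrite eqxx. Qed.

Lemma divisorM y z : divisor y -> divisor z -> divisor (y * z).
Proof.
have nzv := varpi_neq0.
move=> [nzy Dy] [nzz Dz]; split; first by rewrite mulf_neq0.
case: Dy Dz => [] [a Ia ->] [] [b Ib ->].
- by left; exists (a * b); rewrite ?rpredM ?exprMn.
- by right; exists (a * b); [apply: prime_ideal_ideal | rewrite exprMn mulrA].
- by right; exists (a * b); [rewrite mulrC; apply: prime_ideal_ideal | rewrite exprMn mulrAC].
left; exists (a * b / varpi); last by field.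
exact: prime_ideal_mul.
Qed.

Definition divisor_norm (z : K) : nat := Num.truncn `|fnorm z|.

Lemma divisor_normP z : divisor z -> `|fnorm z| = (divisor_norm z)%:R.
Proof.
move=> [_ Dz]; suff [n Dn] : exists n : nat, `|fnorm z| = n%:R by rewrite /divisor_norm
  Dn natrK.
case: Dz => [] [x Ix ->].
  have [n Dn] := fnorm_Z_adjoin Ix; exists (n * n)%N.
  by rewrite expr2 fnormM normrM Dn natrM.
have [k [_ Dk _]] := prime_ideal_fnorm Ix; exists (absz (k * k)).
rewrite natr_absz intr_norm; congr `|_|.
rewrite fnormM fnormV fnorm_varpi expr2 fnormM Dk !intrM.
by move: (k%:~R) => u; field.
Qed.

Lemma divisor_norm_gt0 z : divisor z -> (0 < divisor_norm z)%N.
Proof.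
move=> Dz; rewrite lt0n -(pnatr_eq0 rat) -divisor_normP // normr_eq0 fnorm_eq0.
by case: Dz.
Qed.

Lemma divisor_normM y z : divisor y -> divisor z ->
  divisor_norm (y * z) = (divisor_norm y * divisor_norm z)%N.
Proof.
move=> Dy Dz; apply/eqP; rewrite -(eqr_nat rat) natrM -!divisor_normP ?fnormM ?normrM //.
exact: divisorM.
Qed.

Lemma divisor_norm_unit z : divisor z -> divisor_norm z = 1%N -> divisor z^-1.
Proof.
move=> Dz N1; have := divisor_normP Dz; rewrite N1; case: Dz => nzz [] [x Ix Dx] N1'.
  have nzx : x != 0 by move: nzz; rewrite Dx sqrf_eq0.
  have Nx : `|fnorm x| = 1.
    apply/eqP; rewrite -(@pexpr_eq1 _ _ 2) // -normrX -[_ ^+ 2]/(fnorm x * fnorm x).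
    by rewrite -fnormM -expr2 -Dx N1'.
  by rewrite Dx -exprVn; apply/divisor_sqr; rewrite ?invr_eq0 // fnorm_unit.
have [k [_ Dk /eqP[]]] := prime_ideal_fnorm Ix.
apply: (@intr_inj rat); rewrite intr_norm; apply/eqP.
rewrite -(@pexpr_eq1 _ _ 2) // -normrX; apply/eqP; rewrite -[RHS]N1' Dx; congr `|_|.
rewrite fnormM fnormV fnorm_varpi expr2 fnormM Dk !intrM.
by move: (k%:~R) => u; field.
Qed.

Lemma divisor_cases z : divisor z -> exists2 d, d != 0 & z = d ^+ 2 \/ z = d ^+ 2 * varpi.
Proof.
have nzv := varpi_neq0; move=> [nzz [] [x Ix Dx]].
  by exists x; [move: nzz; rewrite Dx sqrf_eq0 | left].
exists (x / varpi); last by right; rewrite Dx; field.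
by move: nzz; rewrite Dx !mulf_eq0 !negb_or => /andP[/andP[-> _] ->].
Qed.

(** The elements of the ideal whose square is generated by z; y is one of them
    if the ideal divides y O. *)
Definition idl (z y : K) : Prop := y = 0 \/ divisor (y ^+ 2 / z).

Lemma idl_sqr d y : d != 0 -> idl (d ^+ 2) y <-> y / d \in 'O.
Proof.
move=> nzd; have [->|nzy] := eqVneq y 0.
  by rewrite mul0r rpred0; split=> // _; left.
have nzyd : y / d != 0 by rewrite mulf_neq0 ?invr_eq0.
rewrite /idl -exprVn -exprMn; split=> [[y0|/divisor_sqr->//]|Oy].
  by rewrite y0 eqxx in nzy.
by right; apply/divisor_sqr.
Qed.

Lemma idl_varpi d y : d != 0 -> idl (d ^+ 2 * varpi) y <-> y / d \in prime_ideal.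
Proof.
move=> nzd; have nzv := varpi_neq0; have [->|nzy] := eqVneq y 0.
  by rewrite mul0r rpred0; split=> // _; left.
have nzyd : y / d / varpi != 0 by rewrite !mulf_neq0 ?invr_eq0.
have E : y ^+ 2 / (d ^+ 2 * varpi) = (y / d / varpi) ^+ 2 * varpi.
  by field; rewrite nzd nzv.
have := divisor_varpi nzyd; rewrite divfK // -E => iffP.
split=> [[y0|/iffP//]|/iffP]; last by right.
by rewrite y0 eqxx in nzy.
Qed.

Lemma idl_mod z : divisor z -> Omodule (idl z).
Proof.
move=> /divisor_cases[d nzd [] ->]; split=> [x y|a x Oa].
- by move=> /(idl_sqr _ nzd) Ix /(idl_sqr _ nzd) Iy; apply/idl_sqr; rewrite // mulrDl rpredD.
- by move=> /(idl_sqr _ nzd) Ix; apply/idl_sqr; rewrite // -mulrA rpredM.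
- by move=> /(idl_varpi _ nzd) Ix /(idl_varpi _ nzd) Iy; apply/idl_varpi;
  rewrite // mulrDl rpredD.
by move=> /(idl_varpi _ nzd) Ix; apply/idl_varpi; rewrite // -mulrA prime_ideal_ideal.
Qed.

Lemma idl_O z y : divisor z -> idl z y -> y \in 'O.
Proof.
move=> Dz [->|Dyz]; first exact: rpred0.
have [->|nzy] := eqVneq y 0; first exact: rpred0.
apply/divisor_sqr => //; rewrite -(divfK (proj1 Dz) (y ^+ 2)); exact: divisorM.
Qed.

Lemma idl_neq0 z : divisor z -> exists2 y, idl z y & y != 0.
Proof.
move=> /divisor_cases[d nzd [] ->]; first by exists d => //; apply/idl_sqr;
  rewrite // divff ?rpred1.
exists (3 * d); last by rewrite mulf_neq0 ?natr_neq0.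
by apply/idl_varpi; rewrite // mulfK ?three_prime_ideal.
Qed.

(** The hypothesis says that x is in P^-1, and P^-1 = varpi^-1 P. *)
Lemma prime_ideal_inv x :
  (forall p, p \in prime_ideal -> x * p \in 'O) -> x * varpi \in prime_ideal.
Proof.
move=> Ox; rewrite varpi_gens mulrDr !mulrA.
by apply: rpredD; apply: prime_ideal_ideal;
  rewrite ?Ox ?three_prime_ideal ?pgen_prime_ideal ?varpi_cofactor_prime_ideal.
Qed.

(** P is invertible, so that a multiplier of P is an integer. The expression of
    varpi as a sum of products of elements of P, used twice, replaces the
    inverse. *)
Lemma prime_ideal_stab x : (forall p, p \in prime_ideal -> x * p \in prime_ideal) -> x \in 'O.
Proof.
have nzv := varpi_neq0.
move=> Px; rewrite -(mulfK nzv x) varpi_gens mulrDr mulrDl !mulrA -{1 2}varpi_gens.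
by apply: rpredD; rewrite -conductorE prime_ideal_mul ?Px ?three_prime_ideal
  ?pgen_prime_ideal ?varpi_cofactor_prime_ideal.
Qed.

(** To contain is to divide. *)
Lemma idl_contains z w : divisor z -> divisor w -> (forall y, idl w y -> idl z y) ->
  divisor (w / z).
Proof.
have nzv := varpi_neq0.
move=> /divisor_cases[d nzd Dz] /divisor_cases[e nze Dw] wz.
have nzed : e / d != 0 by rewrite mulf_neq0 ?invr_eq0.
have eP p : p \in prime_ideal -> e * p / e \in prime_ideal by rewrite mulrC mulKf.
case: Dz Dw wz => -> [] -> wz.
- rewrite -exprVn -exprMn; apply/divisor_sqr => //; apply/idl_sqr => //.
  by apply: wz; apply/idl_sqr; rewrite // divff ?rpred1.
- have -> : e ^+ 2 * varpi / d ^+ 2 = (e / d) ^+ 2 * varpi by field.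
  apply/divisor_varpi => //; apply: prime_ideal_inv => p Pp.
  have -> : e / d * p = e * p / d by field.
  by apply/idl_sqr => //; apply: wz; apply/idl_varpi; rewrite // mulrC mulKf.
- have nzx : e / d / varpi != 0 by rewrite mulf_neq0 ?invr_eq0.
  have -> : e ^+ 2 / (d ^+ 2 * varpi) = (e / d / varpi) ^+ 2 * varpi.
    by field; rewrite nzd nzv.
  apply/divisor_varpi; rewrite // divfK //.
  by apply/idl_varpi => //; apply: wz; apply/idl_sqr; rewrite // divff ?rpred1.
have -> : e ^+ 2 * varpi / (d ^+ 2 * varpi) = (e / d) ^+ 2 by field; rewrite nzd nzv.
apply/divisor_sqr => //; apply: prime_ideal_stab => p Pp.
have -> : e / d * p = e * p / d by field.
by apply/idl_varpi => //; apply: wz; apply/idl_varpi; rewrite // mulrC mulKf.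
Qed.

Lemma idlM z w x y : idl z x -> idl w y -> idl (z * w) (x * y).
Proof.
move=> [->|Dx]; first by left; rewrite mul0r.
move=> [->|Dy]; first by left; rewrite mulr0.
right; have -> : (x * y) ^+ 2 / (z * w) = x ^+ 2 / z * (y ^+ 2 / w).
  by rewrite invfM exprMn mulrACA.
exact: divisorM.
Qed.

Lemma idl_dvd z w y : divisor z -> divisor (w / z) -> idl w y -> idl z y.
Proof.
move=> [nzz _] Dwz [->|Dy]; first by left.
right; have [w0|nzw] := eqVneq w 0; first by case: Dwz; rewrite w0 mul0r eqxx.
have -> : y ^+ 2 / z = y ^+ 2 / w * (w / z) by field; rewrite nzz nzw.
exact: divisorM.
Qed.

Local Notation irreducible_divisor := (monoid_irreducible divisor).

(** The sum of the ideals p and a is again an ideal z, which divides both. As p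
    is irreducible, either z is p up to a unit, and p divides a, or z is the
    unit ideal; then 1 is the sum of elements of p and of a, and multiplication
    by b shows that p contains b. *)
Lemma divisor_prime p a b : irreducible_divisor p -> divisor a -> divisor b ->
  divisor (a * b / p) -> divisor (a / p) \/ divisor (b / p).
Proof.
move=> [Dp nup irr_p] Da Db Dab.
have [nzp nza] : p != 0 /\ a != 0 by case: Dp; case: Da.
pose J y := exists y1 y2, [/\ idl p y1, idl a y2 & y = y1 + y2].
have modp := idl_mod Dp; have moda := idl_mod Da; have modb := idl_mod Db.
have Jp y : idl p y -> J y.
  by move=> Py; exists y, 0; split; rewrite ?addr0 //; left.
have Ja y : idl a y -> J y.
  by move=> Ay; exists 0, y; split; rewrite ?add0r //; left.
have modJ : Omodule J.
  split=> [_ _ [x [y [px ay ->]]] [x' [y' [px' ay' ->]]] | c _ Oc [x [y [px ay ->]]]].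
    exists (x + x'), (y + y'); split; [exact: (omodD modp) | exact: (omodD moda) | ].
    by rewrite addrACA.
  exists (c * x), (c * y); split; [exact: (omodM modp) | exact: (omodM moda) | ].
  by rewrite mulrDr.
have JO y : J y -> y \in 'O.
  by move=> [y1 [y2 [/(idl_O Dp) O1 /(idl_O Da) O2 ->]]]; rewrite rpredD.
have bndJ : Obounded J by exists 1; rewrite ?oner_neq0 // => y /JO; rewrite mul1r.
have [y0 py0 nzy0] := idl_neq0 Dp.
have [z Dz genJ] : exists2 z, divisor z & forall y, J y <-> idl z y.
  have [d nzd [genJ|genJ]] := class_number_two modJ bndJ (Jp _ py0) nzy0.
    exists (d ^+ 2); last by move=> y; rewrite idl_sqr.
    by apply/divisor_sqr => //; apply: JO; apply/genJ; rewrite divff ?rpred1.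
  exists (d ^+ 2 * varpi); last by move=> y; rewrite idl_varpi.
  apply/divisor_varpi => //; apply: prime_ideal_inv => q Pq.
  by apply: JO; apply/genJ; rewrite mulrC mulKf.
have Dpz : divisor (p / z) by apply: idl_contains => // y /Jp /genJ.
have Daz : divisor (a / z) by apply: idl_contains => // y /Ja /genJ.
have nzz : z != 0 by case: Dz.
have [|Dz'|Dzp] := irr_p z (p / z) Dz Dpz; first by rewrite mulrCA divff ?mulr1.
  right; apply: idl_contains => // y by_.
  have [y1 [y2 [py1 ay2 D1]]] : J 1 by apply/genJ; right; rewrite expr1n div1r.
  rewrite -[y]mulr1 D1 mulrDr; apply: (omodD modp).
    by apply: (omodM modp) => //; exact: idl_O by_.
  by apply: (idl_dvd Dp Dab); rewrite mulrC; apply: idlM.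
left; have -> : a / p = a / z * (p / z)^-1 by field; rewrite nzz nzp.
exact: divisorM.
Qed.

(** A unit of the second form would make P principal. *)
Lemma divisor_unit u : divisor u -> divisor u^-1 ->
  exists d, [/\ d \in 'O, d^-1 \in 'O & u = d ^+ 2].
Proof.
have nzv := varpi_neq0.
move=> Du Du'; have [d nzd Dd] := divisor_cases Du.
case: Dd Du Du' => -> Du Du'.
  exists d; split=> //; first exact/divisor_sqr.
  by apply/divisor_sqr; rewrite ?invr_eq0 // exprVn.
have Pd : d * varpi \in prime_ideal by apply/divisor_varpi.
have nzdv : (d * varpi)^-1 != 0 by rewrite invr_eq0 mulf_neq0.
have E : (d ^+ 2 * varpi)^-1 = (d * varpi)^-1 ^+ 2 * varpi by field; rewrite nzd nzv.
rewrite E in Du'; have := proj1 (divisor_varpi nzdv) Du'.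
have -> : (d * varpi)^-1 * varpi = d^-1 by field; rewrite nzd nzv.
by move=> /(not_principal Pd) []; rewrite mulrAC divff // mul1r.
Qed.

(** * Irreducible elements of R *)

Lemma unit_notin_prime_ideal x : x^-1 \in 'O -> x != 0 -> x \notin prime_ideal.
Proof.
move=> Ox nzx; apply: contra one_notin_prime_ideal => Px.
by rewrite -(mulVf nzx) prime_ideal_ideal.
Qed.

Lemma orderR_unit x : x \in orderR -> x != 0 -> x^-1 \in 'O -> x^-1 \in orderR.
Proof.
move=> Rx nzx Ox; apply: (orderR_cancel Rx) => //; first exact: unit_notin_prime_ideal.
by rewrite divff ?rpred1.
Qed.

Lemma alphaV_O j : (alpha ^+ j)^-1 \in 'O.
Proof.
have -> : (alpha ^+ j)^-1 = (4 + alpha ^+ 2) ^+ j; last by inO.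
rewrite -exprVn; congr (_ ^+ _); apply: (mulfI alpha_neq0).
rewrite divff ?alpha_neq0 //; apply/esym/(@eq_mod_cubic 1); ring.
Qed.

Definition orderR_irreducible x := [/\ x \in orderR, x != 0, x^-1 \notin orderR &
  forall a b, a \in orderR -> b \in orderR -> x = a * b ->
    a^-1 \in orderR \/ b^-1 \in orderR].

(** A factor q of x that is not in P can be multiplied by a power of alpha to
    lie in R, and then the cofactor lies in R as well. *)
Lemma orderR_cofactor x q : orderR_irreducible x -> q \in 'O -> q \notin prime_ideal ->
  q^-1 \notin 'O -> x / q \in 'O -> (x / q)^-1 \in 'O.
Proof.
move=> [Rx nzx _ irr_x] Oq notPq nuq Oxq.
have nzq : q != 0 by apply: contraNneq notPq => ->; rewrite rpred0.
have nza j : alpha ^+ j != 0 by rewrite expf_neq0 ?alpha_neq0.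
have [j Rq] := unit_mul_orderR Oq; set q' := _ * q in Rq.
have Dx : x = q' * (x / q / alpha ^+ j) by rewrite /q'; field; rewrite nzq nza.
have notPq' : q' \notin prime_ideal.
  apply: contra notPq => Pq'.
  have -> : q = (alpha ^+ j)^-1 * q' by rewrite /q' mulKf ?nza.
  by rewrite prime_ideal_ideal ?alphaV_O.
have Ry : x / q / alpha ^+ j \in orderR.
  by apply: (orderR_cancel Rq) => //; [rewrite rpredM ?alphaV_O | rewrite -Dx].
have [/orderR_O Oq'|/orderR_O Oy] := irr_x _ _ Rq Ry Dx.
  case/negP: nuq; have -> : q^-1 = alpha ^+ j * q'^-1 by rewrite /q'; field; rewrite nzq nza.
  by rewrite rpredM // rpredX.
have -> : (x / q)^-1 = (alpha ^+ j)^-1 * (x / q / alpha ^+ j)^-1.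
  by field; rewrite nzq nzx nza.
by rewrite rpredM ?alphaV_O.
Qed.

(** An element of P is a unit multiple of an element of R, and a cofactor in I
    stays in I, hence in R, when it is divided by the unit; so a product of an
    element of P and one of I is reducible in R. *)
Lemma orderR_not_P3 x q : orderR_irreducible x -> q \in prime_ideal -> q != 0 ->
  x / q \notin conductor.
Proof.
move=> [Rx nzx _ irr_x] Pq nzq; apply/negP=> Ixq.
have nza j : alpha ^+ j != 0 by rewrite expf_neq0 ?alpha_neq0.
have [j Rq] := unit_mul_orderR (prime_ideal_O Pq); set q' := _ * q in Rq.
have Dx : x = q' * (x / q / alpha ^+ j) by rewrite /q'; field; rewrite nzq nza.
have Pq' : q' \in prime_ideal by rewrite /q' prime_ideal_ideal // rpredX.
have Iy : x / q / alpha ^+ j \in conductor by rewrite mulrC conductor_ideal ?alphaV_O.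
have nzq' : q' != 0 by rewrite /q' mulf_neq0 ?nza.
have nzy : x / q / alpha ^+ j != 0 by rewrite !mulf_neq0 ?invr_eq0 ?nza.
have [/orderR_O Oq'|/orderR_O Oy] := irr_x _ _ Rq (conductor_orderR Iy) Dx.
  by rewrite (negPf (unit_notin_prime_ideal Oq' nzq')) in Pq'.
by have := conductor_prime_ideal Iy; rewrite (negPf (unit_notin_prime_ideal Oy nzy)).
Qed.

(** Principal ideals are those represented by squares. For a prime ideal the
    weight is 2 if it is principal and 1 otherwise, so that an irreducible of R
    has weight 2. *)
Definition divisor_weight (p : K) : nat := if `[< exists d, p = d ^+ 2 >] then 2 else 1.

Lemma divisor_weight_unit u p : divisor u -> divisor u^-1 ->
  divisor_weight (u * p) = divisor_weight p.
Proof.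
move=> Du Du'; have [e [_ _ De]] := divisor_unit Du Du'.
have nze : e != 0 by case: Du; rewrite De sqrf_eq0.
congr (if _ then _ else _); apply/asboolP/asboolP => [] [d Dd].
  by exists (d / e); rewrite exprMn exprVn -Dd De; field.
by exists (e * d); rewrite Dd De exprMn.
Qed.

Lemma prod_divisor l : {in l, forall p, irreducible_divisor p} ->
  divisor (\prod_(p <- l) p).
Proof.
move=> irr_l; rewrite big_seq; apply: (big_ind divisor) => [|y z|p lp].
- exact: divisor1.
- exact: divisorM.
by have [] := irr_l p lp.
Qed.

Lemma prod_irreducible_unit l : {in l, forall p, irreducible_divisor p} ->
  divisor (\prod_(p <- l) p)^-1 -> l = [::].
Proof.
case: l => // p l irr_l; have [Dp nup _] := irr_l p (mem_head _ _).
have irr_l' : {in l, forall p, irreducible_divisor p}.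
  by move=> q lq; apply: irr_l; rewrite inE lq orbT.
have Dl := prod_divisor irr_l'; rewrite big_cons invfM => Du; case: nup.
by have := divisorM Du Dl; rewrite divfK //; case: Dl.
Qed.

Lemma divisor_varpi_id : divisor varpi.
Proof.
have nzv := varpi_neq0; split=> //; right; exists varpi; last by field.
exact: varpi_prime_ideal.
Qed.

Lemma varpi_not_unit : ~ divisor varpi^-1.
Proof.
move=> Dv; have [d [_ _ Dd]] := divisor_unit divisor_varpi_id Dv.
exact: (@varpi_nonsquare d).
Qed.

(** If q were in P then P would divide the prime ideal q O and so be equal to it,
    but P is not principal. *)
Lemma sqr_irreducible_notin q : irreducible_divisor (q ^+ 2) -> q != 0 -> q \notin prime_ideal.
Proof.
have nzv := varpi_neq0; move=> [Dq _ irr_q] nzq; apply/negP=> Pq.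
have Dqv : divisor (q ^+ 2 / varpi).
  by split; [rewrite mulf_neq0 ?expf_neq0 ?invr_eq0 | right; exists q].
have [|Dv|Dv] := irr_q _ _ divisor_varpi_id Dqv.
- by rewrite mulrCA divff ?mulr1.
- exact: varpi_not_unit.
have [d [Od Od' Dd]] := divisor_unit Dqv Dv.
apply: (@varpi_nonsquare (q / d)); rewrite exprMn exprVn -Dd.
by field; rewrite nzq nzv.
Qed.

Lemma nonsquare_divisor p : divisor p -> ~ (exists d, p = d ^+ 2) ->
  exists2 x, x \in prime_ideal & p = x ^+ 2 / varpi /\ x != 0.
Proof.
move=> [nzp [] [x Ox Dx]] nsq; first by case: nsq; exists x.
exists x => //; split=> //; move: nzp; rewrite Dx mulf_eq0 negb_or => /andP[+ _].
by rewrite sqrf_eq0.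
Qed.

(** Since the class group has order 2, the product of two nonprincipal primes is
    generated by some q. It is in P if one of the primes is P, that is,
    represented by varpi up to a unit, and it is not in P if neither is. *)
Lemma nonsquare_pair p1 p2 : divisor p1 -> divisor p2 ->
    ~ (exists d, p1 = d ^+ 2) -> ~ (exists d, p2 = d ^+ 2) ->
  exists q, [/\ q \in 'O, q != 0, p1 * p2 = q ^+ 2,
     divisor (p2 / varpi) -> q \in prime_ideal &
     ~ divisor (p1 / varpi) -> ~ divisor (p2 / varpi) -> q \notin prime_ideal].
Proof.
have nzv := varpi_neq0.
move=> D1 D2 /(nonsquare_divisor D1)[x Px [-> nzx]] /(nonsquare_divisor D2)[y Py [-> nzy]].
have Evv (z : K) : z ^+ 2 / varpi / varpi = (z / varpi) ^+ 2 by field.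
have nz2 z : z != 0 -> z / varpi != 0 by move=> nzz; rewrite mulf_neq0 ?invr_eq0.
exists (x * y / varpi); split.
- by rewrite -conductorE prime_ideal_mul.
- by rewrite !mulf_neq0 ?invr_eq0.
- by field.
- rewrite Evv => /divisor_sqr - /(_ (nz2 _ nzy)) Oy.
  by rewrite -mulrA mulrC prime_ideal_ideal.
rewrite !Evv !divisor_sqr ?nz2 // => Ox Oy; apply/negP=> Pq.
have : (theta * x) * (theta * y) \in prime_ideal.
  have -> : theta * x * (theta * y) = (1 - alpha) * (x * y / varpi).
    by rewrite -theta_sqr; field.
  by apply: prime_ideal_ideal => //; inO.
have [Otx Oty] : theta * x \in 'O /\ theta * y \in 'O by case/andP: Px; case/andP: Py.
case/(prime_ideal_prime Otx Oty) => /prime_ideal_theta_conductor H.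
  by apply: Ox; rewrite -conductorE H // prime_ideal_O.
by apply: Oy; rewrite -conductorE H // prime_ideal_O.
Qed.

Lemma divisor_sqr_unit x : x != 0 -> divisor (x ^+ 2)^-1 -> x^-1 \in 'O.
Proof. by move=> nzx; rewrite -exprVn => /divisor_sqr; apply; rewrite invr_eq0. Qed.

(** A principal factor q of y that is prime to P accounts for all the prime
    ideal factors of y. *)
Lemma weight_two_cofactor y q l : orderR_irreducible y -> q \in 'O -> q \notin prime_ideal ->
    ~ divisor (q ^+ 2)^-1 -> {in l, forall p, irreducible_divisor p} ->
    (exists2 e, divisor e /\ divisor e^-1 & y ^+ 2 = e * (q ^+ 2 * \prod_(p <- l) p)) ->
  l = [::].
Proof.
move=> irr_y Oq notPq nuq irr_l [e [De De'] Dy].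
have nzq : q != 0 by apply: contraNneq notPq => ->; rewrite rpred0.
have nzy : y != 0 by case: irr_y.
have nze : e != 0 by case: De.
have nzyq : y / q != 0 by rewrite mulf_neq0 ?invr_eq0.
have Dyq : (y / q) ^+ 2 = e * \prod_(p <- l) p by rewrite exprMn exprVn Dy; field.
apply: prod_irreducible_unit => //.
have -> : (\prod_(p <- l) p)^-1 = e * (y / q)^-1 ^+ 2.
  by rewrite exprVn Dyq invfM mulVKf.
apply: divisorM => //; apply/divisor_sqr; first by rewrite invr_eq0.
apply: (orderR_cofactor irr_y) => //.
  apply/negP=> Oq'; apply: nuq; rewrite -exprVn; apply/divisor_sqr => //.
  by rewrite invr_eq0.
by apply/divisor_sqr => //; rewrite Dyq; apply: divisorM => //; apply: prod_divisor.
Qed.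

(** A principal prime factor of x is different from P and its cofactor is a
    unit. Otherwise all prime factors are nonprincipal and their number is even.
    If two of them differ from P, their product is principal and prime to P, so
    the cofactor is a unit. If at most one differs from P and there are four or
    more, then x is a product of an element of P and an element of I, which an
    irreducible is not. *)
Lemma irreducible_weight_two x : orderR_irreducible x -> exists l u,
  [/\ {in l, forall p, irreducible_divisor p}, divisor u /\ divisor u^-1,
      x ^+ 2 = u * \prod_(p <- l) p & (\sum_(p <- l) divisor_weight p = 2)%N].
Proof.
move=> irr_x; have [Rx nzx nux _] := irr_x; have nzv := varpi_neq0.
have nux' : x^-1 \notin 'O by apply: contra nux; apply: orderR_unit.
have Dx2 : divisor (x ^+ 2) by apply/divisor_sqr => //; apply: orderR_O.
have [l [u [irr_l Du Du' Dx]]] := monoid_factorization divisor1 divisorM divisor_norm_gt0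
  divisor_normM
  divisor_norm_unit Dx2.
exists l, u; split=> //.
have unitE : exists2 e, divisor e /\ divisor e^-1 & x ^+ 2 = e * \prod_(p <- l) p by exists u.
have nzu : u != 0 by case: Du.
have [[p lp [q Dp]]|nosq] := EM (exists2 p, p \in l & exists q, p = q ^+ 2).
  have perm_l := perm_to_rem lp; have irr_p := irr_l p lp.
  have Dpp : divisor p by case: irr_p.
  have nzq : q != 0 by case: Dpp; rewrite Dp sqrf_eq0.
  rewrite (perm_big _ perm_l) big_cons.
  have -> : rem p l = [::].
    apply: (@weight_two_cofactor x q) => //.
    - by apply/divisor_sqr => //; rewrite -Dp.
    - by apply: sqr_irreducible_notin => //; rewrite -Dp.
    - by rewrite -Dp; case: irr_p.
    - by move=> r /mem_rem/irr_l.
    by exists u => //; rewrite Dx (perm_big _ perm_l) big_cons /= Dp.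
  by rewrite big_nil /= addn0 /divisor_weight; case: asboolP => // [[]]; exists q.
have weight1 p : p \in l -> divisor_weight p = 1%N.
  by move=> lp; rewrite /divisor_weight; case: asboolP => // sq; case: nosq; exists p.
have nsq p : p \in l -> ~ exists d, p = d ^+ 2 by move=> lp sq; apply: nosq; exists p.
have Dl p : p \in l -> divisor p by move=> /irr_l[].
pose a (p : K) := ~~ `[< divisor (p / varpi) >].
have perm_l : perm_eq (filter a l ++ filter (predC a) l) l by rewrite perm_filterC.
suff size2 : size l = 2%N.
  rewrite big_seq (eq_bigr (fun=> 1%N)); last by move=> p /weight1.
  by rewrite -big_seq sum1_size.
rewrite -(perm_size perm_l).
have {unitE} : exists2 e, divisor e /\ divisor e^-1 &
    x ^+ 2 = e * \prod_(p <- filter a l ++ filter (predC a) l) p.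
  by case: unitE => e De ->; exists e => //; rewrite (perm_big _ perm_l).
have memA p : p \in filter a l -> p \in l /\ ~ divisor (p / varpi).
  by rewrite mem_filter => /andP[/negP ap lp]; split=> // /asboolP.
have memB p : p \in filter (predC a) l -> p \in l /\ divisor (p / varpi).
  by rewrite mem_filter /= negbK => /andP[/asboolP].
move: memA memB; move: (filter a l) (filter (predC a) l) => A B memA memB [e De Dxe].
have [De1 De2] := De.
have [d [_ _ Dd]] := divisor_unit De1 De2.
have nzd : d != 0 by case: De1; rewrite Dd sqrf_eq0.
have tail p1 C : p1 \in l -> (forall p, p \in C -> p \in l /\ divisor (p / varpi)) ->
    x ^+ 2 = e * \prod_(p <- p1 :: C) p -> size (p1 :: C) = 2%N.
  have Emul (y z t : K) : e * (y * (z * t)) = e * (y * z) * t by rewrite !mulrA.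
  case: C => [|p2 [|p3 [|p4 C]]] l1 memC //.
  - rewrite big_seq1 => Dx1; case: (nsq _ l1); exists (x / d).
    by rewrite exprMn exprVn Dx1 Dd; field.
  - have [l2 v2] := memC p2 (mem_head _ _).
    have [l3 v3] : p3 \in l /\ divisor (p3 / varpi) by apply: memC; rewrite !inE eqxx orbT.
    have [q [Oq nzq Dq _ _]] := nonsquare_pair (Dl _ l1) (Dl _ l2) (nsq _ l1) (nsq _ l2).
    rewrite !big_cons big_nil mulr1 Emul Dq => Dx3.
    case: (nsq _ l3); exists (x / d / q).
    by rewrite !exprMn !exprVn Dx3 Dd; field; rewrite nzd nzq.
  have [l2 v2] := memC p2 (mem_head _ _).
  have [l3 v3] : p3 \in l /\ divisor (p3 / varpi) by apply: memC; rewrite !inE eqxx orbT.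
  have [l4 v4] : p4 \in l /\ divisor (p4 / varpi) by apply: memC; rewrite !inE eqxx !orbT.
  have [q [Oq nzq Dq Pq _]] := nonsquare_pair (Dl _ l1) (Dl _ l2) (nsq _ l1) (nsq _ l2).
  rewrite !big_cons Emul Dq => Dx4.
  case/negP: (orderR_not_P3 irr_x (Pq v2) nzq); rewrite conductorE.
  apply/divisor_sqr; first by rewrite !mulf_neq0 ?invr_eq0.
  have -> : (x / q / varpi) ^+ 2 = e * (p3 / varpi) * (p4 / varpi) * \prod_(p <- C) p.
    by rewrite !exprMn !exprVn Dx4; field; rewrite nzq nzv.
  apply: divisorM; first by apply: divisorM => //; apply: divisorM.
  apply: prod_divisor => p Cp; apply: irr_l.
  by have [] := memC p; rewrite // !inE Cp !orbT.
case: A => [|p1 [|p2 A]] in memA Dxe *.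
- case: B memB Dxe => [|p1 B] memB Dxe.
    case/negP: nux'; apply: divisor_sqr_unit => //.
    by rewrite Dxe big_nil mulr1.
  apply: tail => // [|p Bp]; first by have [] := memB p1 (mem_head _ _).
  by apply: memB; rewrite inE Bp orbT.
- by apply: tail => //; have [] := memA p1 (mem_head _ _).
have [l1 v1] := memA p1 (mem_head _ _).
have [l2 v2] : p2 \in l /\ ~ divisor (p2 / varpi) by apply: memA; rewrite !inE eqxx orbT.
have [q [Oq nzq Dq _ notPq]] := nonsquare_pair (Dl _ l1) (Dl _ l2) (nsq _ l1) (nsq _ l2).
suff /= -> : A ++ B = [::] by [].
apply: (@weight_two_cofactor x q) => //; first exact: notPq.
- rewrite -Dq invfM => Dq'; have [_ nup _] := irr_l _ l1; apply: nup.
  by have := divisorM Dq' (Dl _ l2); rewrite divfK //; case: (Dl _ l2).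
- move=> p; rewrite mem_cat => /orP[Ap|Bp]; apply: irr_l.
    by have [] := memA p; rewrite // !inE Ap !orbT.
  by have [] := memB p.
by exists e => //; rewrite Dxe /= !big_cons -Dq !mulrA.
Qed.

Lemma orderR_prod_weight s : {in s, forall x, orderR_irreducible x} -> exists l u,
  [/\ {in l, forall p, irreducible_divisor p}, divisor u /\ divisor u^-1,
      (\prod_(x <- s) x) ^+ 2 = u * \prod_(p <- l) p
    & (\sum_(p <- l) divisor_weight p = 2 * size s)%N].
Proof.
elim: s => [|x s IHs] irr_s.
  exists [::], 1; split=> //; rewrite ?invr1 ?big_nil ?expr1n ?mulr1 ?muln0 //.
  by split; exact: divisor1.
have [|l [u [irr_l [Du Du'] Dl wl]]] := IHs.
  by move=> y sy; apply: irr_s; rewrite inE sy orbT.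
have [k [v [irr_k [Dv Dv'] Dk wk]]] := irreducible_weight_two (irr_s x (mem_head _ _)).
exists (k ++ l), (v * u); split.
- by move=> p; rewrite mem_cat => /orP[/irr_k | /irr_l].
- by rewrite invfM; split; apply: divisorM.
- by rewrite big_cons exprMn Dk Dl big_cat mulrACA.
by rewrite big_cat /= wk wl mulnS.
Qed.

Lemma orderR_lengths s t :
    {in s, forall x, orderR_irreducible x} -> {in t, forall x, orderR_irreducible x} ->
  \prod_(x <- s) x = \prod_(x <- t) x -> size s = size t.
Proof.
move=> irr_s irr_t Dst.
have [l [u [irr_l [Du Du'] Dl wl]]] := orderR_prod_weight irr_s.
have [k [v [irr_k [Dv Dv'] Dk wk]]] := orderR_prod_weight irr_t.
have E : u * \prod_(p <- l) p = v * \prod_(p <- k) p by rewrite -Dl -Dk Dst.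
have [nzu nzv] : u != 0 /\ v != 0 by case: Du; case: Dv.
have nzl : \prod_(p <- l) p != 0 by case: (prod_divisor irr_l).
have nzk : \prod_(p <- k) p != 0 by case: (prod_divisor irr_k).
apply/eqP; rewrite -(@eqn_pmul2l 2) // -wl -wk; apply/eqP.
apply: (factorization_weight divisor0 divisor1 divisorM divisor_prime
  divisor_weight_unit) => //.
  have -> : (\prod_(p <- l) p) / \prod_(p <- k) p = v * u^-1.
    by apply: (mulfI nzu); apply: (mulIf nzk); rewrite mulrA divfK // E; field.
  exact: divisorM.
have -> : (\prod_(p <- k) p) / \prod_(p <- l) p = u * v^-1.
  by apply: (mulfI nzv); apply: (mulIf nzl); rewrite mulrA divfK // -E; field.
exact: divisorM.
Qed.

(** Induction on the absolute value of the norm. *)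
Lemma orderR_factorization x : x \in orderR -> x != 0 -> x^-1 \notin orderR ->
  exists2 s, {in s, forall y, orderR_irreducible y} & x = \prod_(y <- s) y.
Proof.
move=> Rx nzx nux; have [n Dn] := fnorm_Z_adjoin (orderR_O Rx).
have [m] := ssrnat.ubnP n; elim: m n x Rx nzx nux Dn => // m IHm n x Rx nzx nux Dn lt_n.
have [irr_x|] := EM (orderR_irreducible x).
  by exists [:: x]; rewrite ?big_seq1 // => y /[!inE] /eqP->.
move=> red_x; have [a [b [Ra Rb Dx [nua nub]]]] : exists a b,
    [/\ a \in orderR, b \in orderR, x = a * b & a^-1 \notin orderR /\ b^-1 \notin orderR].
  apply: contra_notP red_x => irr_x; split=> // a b Ra Rb Dx.
  apply: contra_notP irr_x => /not_orP[/negP nua /negP nub]; by exists a, b.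
have [nza nzb] : a != 0 /\ b != 0 by apply/andP; rewrite -negb_or -mulf_eq0 -Dx.
have [k Dk] := fnorm_Z_adjoin (orderR_O Ra); have [l Dl] := fnorm_Z_adjoin (orderR_O Rb).
have big c j : c \in orderR -> c != 0 -> c^-1 \notin orderR -> `|fnorm c| = j%:R -> (1 < j)%N.
  move=> Rc nzc nuc Dj; case: j Dj => [|[|//]] Dj.
    by move/eqP: Dj; rewrite normr_eq0 fnorm_eq0 (negPf nzc).
  by case/negP: nuc; apply: orderR_unit => //; apply: fnorm_unit; rewrite ?orderR_O.
have [k1 l1] := (big a k Ra nza nua Dk, big b l Rb nzb nub Dl).
have Dkl : n = (k * l)%N.
  by apply/eqP; rewrite -(eqr_nat rat) -Dn Dx fnormM normrM Dk Dl natrM.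
rewrite ltnS Dkl in lt_n.
have [|s irr_s Da] := IHm k a Ra nza nua Dk.
  by apply: leq_trans lt_n; rewrite ltn_Pmulr // ltnW.
have [|t irr_t Db] := IHm l b Rb nzb nub Dl.
  by apply: leq_trans lt_n; rewrite ltn_Pmull // ltnW.
exists (s ++ t); last by rewrite big_cat /= -Da -Db.
by move=> y; rewrite mem_cat => /orP[/irr_s | /irr_t].
Qed.

(** * The order R as a ring *)

Lemma dim_K : \dim {:K} = 3%N.
Proof. by rewrite -(size_basis power_basis_basis). Qed.

(** A linear relation over the rationals becomes one over the integers when it
    is multiplied by the product of the denominators. *)
Lemma Zfree_size m (v : 'I_m -> K) : Zfree v -> (m <= \dim {:K})%N.
Proof.
move=> free_v; have free_t : free [tuple v i | i < m].
  apply/freeP=> k; under eq_bigr do rewrite -tnth_nth tnth_mktuple.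
  move=> Ek; pose D i := \prod_(j < m | j != i) denq (k j).
  pose c i := numq (k i) * D i.
  have Dc i : (\prod_(j < m) denq (k j))%:~R * k i = (c i)%:~R.
    by rewrite (bigD1 i) //= -/(D i) /c !intrM numqE mulrAC [k i * _]mulrC.
  have c0 : \sum_i v i *~ c i = 0.
    transitivity ((\prod_(j < m) denq (k j))%:~R *: (\sum_i k i *: v i)).
      rewrite scaler_sumr; apply: eq_bigr => i _.
      by rewrite scalerA Dc scaler_int.
    by rewrite Ek scaler0.
  move=> i; have /eqP := free_v c c0 i; rewrite mulf_eq0 => /orP[|].
    by rewrite numq_eq0 => /eqP.
  by rewrite /D (negPf (_ : \prod_(j < m | j != i) denq (k j) != 0)) // prodf_seq_neq0;
    apply/allP=> j _; rewrite denq_neq0 implybT.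
rewrite -(size_tuple [tuple v i | i < m]) -(eqnP free_t).
by rewrite dimvS ?subvf.
Qed.

Lemma orderR_rank : has_Zrank orderR (\dim {:K}).
Proof.
split; last by move=> m v _; exact: Zfree_size.
rewrite dim_K; exists (fun i : 'I_3 => alpha ^+ i * (3 * 3)).
  move=> i; apply: conductor_orderR; rewrite conductor_ideal ?rpredX //.
  by rewrite prime_ideal_mul ?three_prime_ideal.
move=> c; rewrite !big_ord_recl big_ord0 addr0 /= => E.
have nz9 : 3 * 3 != 0 :> K by rewrite mulf_neq0 ?natr_neq0.
have [|c0 c1 c2 i] :=
  @emb_intr_inj (c ord0) (c (lift ord0 ord0)) (c (lift ord0 (lift ord0 ord0))) 0 0 0.
  apply: (mulfI nz9); rewrite mulr0z !mul0r !addr0 mulr0 -[RHS]E.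
  rewrite -(mulrzr (_ * _) (c ord0)) -(mulrzr _ (c (lift ord0 ord0))).
  by rewrite -(mulrzr _ (c (lift ord0 (lift ord0 ord0)))); ring.
case: (unliftP ord0 i) => [j|] -> //; case: (unliftP ord0 j) => [k|] -> //.
by rewrite [k]ord1.
Qed.

Lemma orderR_integral : {subset orderR <= ring_of_integers K}.
Proof. by move=> x Rx; rewrite ring_of_integersE orderR_O. Qed.

Definition the_order : number_order K :=
  NumberOrder orderR_subring orderR_integral orderR_rank.

Lemma ideal_genE : ideal_gen [:: 3; 2 + 2 * alpha + alpha ^+ 2] =i prime_ideal.
Proof.
move=> x; apply/asboolP/idP => [[c Oc ->] | /prime_ideal_gens[s [t [Os Ot ->]]]].
  rewrite !big_ord_recl big_ord0 addr0 /=.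
  by apply: rpredD; apply: prime_ideal_ideal;
    rewrite -?ring_of_integersE ?three_prime_ideal ?pgen_prime_ideal.
exists (fun i => if i is 0 then s else t); first by move=> [|i]; rewrite ring_of_integersE.
by rewrite !big_ord_recl big_ord0 addr0 /=; rewrite /pgen; ring.
Qed.

Lemma ideal_mulE (P : {pred K}) : P =i prime_ideal -> ideal_mul P P =i conductor.
Proof.
move=> PE x; apply/asboolP/idP => [[s Ps ->] | Ix].
  rewrite big_seq rpred_sum // => p sp; have [] := Ps p sp.
  by rewrite !PE; apply: prime_ideal_mul.
have nzv := varpi_neq0; move: Ix; rewrite conductorE; set z := x / varpi => Oz.
have -> : x = 3 * (z * 3) + pgen * (z * (- 2 + alpha - alpha ^+ 2)).
  by rewrite -[x](divfK nzv) -/z {1}varpi_gens; ring.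
exists [:: (3, z * 3); (pgen, z * (- 2 + alpha - alpha ^+ 2))]; last first.
  by rewrite !big_cons big_nil addr0.
by move=> p /[!inE] /orP[] /eqP-> /=;
  rewrite !PE ?three_prime_ideal ?pgen_prime_ideal prime_ideal_ideal
  ?three_prime_ideal ?varpi_cofactor_prime_ideal.
Qed.

Lemma Z_plusE (I : {pred K}) : I =i conductor -> orderR =i Z_plus I.
Proof.
move=> IE x; apply/orderRP/asboolP => [[n In] | [n [y Iy ->]]].
  by exists n, (x - n%:~R); rewrite ?IE // addrC subrK.
by exists n; rewrite addrC addKr -IE.
Qed.

Local Notation A := (order_ring the_order).
Local Notation v := (@order_val K the_order).

Lemma order_val_R (x : A) : v x \in orderR. Proof. exact: order_valP. Qed.

Definition to_order (x : K) : A := insubd 0 x.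

Lemma to_orderK x : x \in orderR -> v (to_order x) = x.
Proof. by move=> Rx; rewrite /to_order -[v _]/(val _) insubdK. Qed.

Lemma order_val_inj : injective v. Proof. exact: val_inj. Qed.

Lemma order_valM : {morph v : x y / x * y}. Proof. by []. Qed.

Lemma order_val1 : v 1 = 1. Proof. by []. Qed.

Lemma order_val0 : v 0 = 0. Proof. by []. Qed.

Lemma order_val_sum I r (P : pred I) F :
  v (\sum_(i <- r | P i) F i) = \sum_(i <- r | P i) v (F i).
Proof. exact: (big_morph v (fun _ _ => erefl) order_val0). Qed.

Lemma order_val_prod I r (P : pred I) F :
  v (\prod_(i <- r | P i) F i) = \prod_(i <- r | P i) v (F i).
Proof. exact: (big_morph v order_valM order_val1). Qed.

Lemma order_val_eq0 (x : A) : (v x == 0) = (x == 0).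
Proof. by rewrite -order_val0 (inj_eq order_val_inj). Qed.

Lemma order_unitP (x : A) : is_unit x <-> v x != 0 /\ (v x)^-1 \in orderR.
Proof.
split=> [[y /(congr1 v)] | [nzx Rx]].
  rewrite order_valM order_val1 => Dxy.
  have nzx : v x != 0.
    by apply/eqP=> x0; move/eqP: Dxy; rewrite x0 mul0r eq_sym oner_eq0.
  by split=> //; rewrite -[_^-1]mulr1 -Dxy mulKf ?order_val_R.
by exists (to_order (v x)^-1); apply: order_val_inj;
  rewrite order_valM order_val1 to_orderK ?divff.
Qed.

Lemma order_irreducible (x : A) : irreducible x <-> orderR_irreducible (v x).
Proof.
split=> [[nzx nux irr_x] | [Rx nzx nux irr_x]].
  have nzv : v x != 0 by rewrite order_val_eq0; apply/eqP.
  split=> //; first exact: order_val_R.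
    by apply/negP=> Rx; apply: nux; apply/order_unitP.
  move=> a b Ra Rb Dx.
  have [|/order_unitP[_]|/order_unitP[_]] := irr_x (to_order a) (to_order b).
  - by apply: order_val_inj; rewrite order_valM !to_orderK.
  - by rewrite to_orderK //; left.
  by rewrite to_orderK //; right.
split; first by move/eqP; rewrite -order_val_eq0 (negPf nzx).
  by move/order_unitP=> [_]; rewrite (negPf nux).
move=> a b Dx; have Dv : v x = v a * v b by rewrite Dx order_valM.
have [nza nzb] : v a != 0 /\ v b != 0 by apply/andP; rewrite -negb_or -mulf_eq0 -Dv.
have [Ra|Rb] := irr_x _ _ (order_val_R a) (order_val_R b) Dv.
  by left; apply/order_unitP.
by right; apply/order_unitP.
Qed.

Lemma order_HFD : HFD A.
Proof.
split.
- move=> x y /(congr1 v) /eqP; rewrite order_valM order_val0 mulf_eq0.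
  by rewrite !order_val_eq0.
- move=> x nzx nux.
  have nzv : v x != 0 by rewrite order_val_eq0; apply/eqP.
  have nuv : (v x)^-1 \notin orderR by apply/negP=> Rx; apply: nux; apply/order_unitP.
  have [s irr_s Dx] := orderR_factorization (order_val_R x) nzv nuv.
  have Rs : {in s, forall y, y \in orderR} by move=> y /irr_s[].
  exists (map to_order s).
    by move=> _ /mapP[y sy ->]; apply/order_irreducible; rewrite to_orderK;
      [exact: irr_s | exact: Rs].
  apply: order_val_inj; rewrite order_val_prod big_map Dx [LHS]big_seq [RHS]big_seq.
  by apply: eq_bigr => y sy; rewrite to_orderK ?Rs.
move=> s t irr_s irr_t /(congr1 v); rewrite !order_val_prod => Dst.
rewrite -(size_map v s) -(size_map v t); apply: orderR_lengths.
- by move=> _ /mapP[y sy ->]; apply/order_irreducible/irr_s.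
- by move=> _ /mapP[y ty ->]; apply/order_irreducible/irr_t.
by rewrite !big_map.
Qed.

(** * Power series over R *)

Definition conv (s t : nat -> K) n := \sum_(i < n.+1) s i * t (n - i)%N.

(** Gauss's lemma for P: look at the first coefficients of the two series that
    are not in P. *)
Lemma gauss_prime_ideal (s t : nat -> K) : (forall n, s n \in 'O) -> (forall n, t n \in 'O) ->
    (forall n, conv s t n \in prime_ideal) ->
  (forall n, s n \in prime_ideal) \/ (forall n, t n \in prime_ideal).
Proof.
move=> Os Ot Pst; apply: contrapT => /not_orP[/existsNP[i0 /negP ns] /existsNP[j0 /negP nt]].
have exi : exists i, s i \notin prime_ideal by exists i0.
have exj : exists j, t j \notin prime_ideal by exists j0.
case: (ex_minnP exi) => i nsi mini; case: (ex_minnP exj) => j ntj minj.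
have lt_i : (i < (i + j).+1)%N by rewrite ltnS leq_addr.
have := Pst (i + j)%N; rewrite /conv (bigD1 (Ordinal lt_i)) //= addKn.
set rest := \sum_(k < _ | _) _ => Psum.
have Prest : rest \in prime_ideal.
  apply: rpred_sum => k ne_ki.
  have {ne_ki} : (k : nat) != i by apply: contraNneq ne_ki => ki; apply/eqP/val_inj.
  rewrite neq_ltn => /orP[lt_ki | lt_ik].
    rewrite mulrC; apply: prime_ideal_ideal => //.
    by apply: contraLR lt_ki => nsk; rewrite -leqNgt mini.
  apply: prime_ideal_ideal => //; apply: contraLR lt_ik => ntk; rewrite -leqNgt.
  by have := minj _ ntk; have := ltn_ord k; clear; lia.
have : s i * t j \in prime_ideal by rewrite -(addrK rest (s i * t j)) rpredB.
by case/(prime_ideal_prime (Os i) (Ot j)) => H; [rewrite H in nsi | rewrite H in ntj].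
Qed.

Lemma conv_scale c (s t : nat -> K) n : conv (fun i => c * s i) t n = c * conv s t n.
Proof. by rewrite /conv mulr_sumr; apply: eq_bigr => i _; rewrite mulrA. Qed.

Lemma order_coefM (f g : fps A) n :
  v (fps_coef (f * g) n) = conv (v \o fps_coef f) (v \o fps_coef g) n.
Proof. by rewrite fps_coefM order_val_sum. Qed.

(** The intersection of R and P is 3 Z + I, and theta 3 = 1 + alpha. *)
Lemma orderR_prime_ideal x : x \in orderR -> x \in prime_ideal ->
  exists m : int, theta * x - (1 + alpha) * m%:~R \in prime_ideal.
Proof.
move=> /orderRP[n In] Px.
have [m Dn] : exists m, n = 3 * m.
  by apply: int_prime_ideal3; rewrite -(subKr x n%:~R) rpredB // conductor_prime_ideal.
exists m; have -> : theta * x - (1 + alpha) * m%:~R = theta * (x - n%:~R).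
  by rewrite -theta3 Dn intrM; ring.
exact: theta_conductor.
Qed.

(** The elements of R and P are in 3 Z + I, so a sum of products of two of them
    is in 9 Z + P^3, which does not contain varpi. *)
Lemma conv_prime_ideal (s t : nat -> K) :
    (forall n, s n \in orderR) -> (forall n, t n \in orderR) ->
    (forall n, s n \in prime_ideal) -> (forall n, t n \in prime_ideal) ->
  conv s t 1 <> varpi.
Proof.
move=> Rs Rt Ps Pt; rewrite /conv !big_ord_recl big_ord0 addr0 /= => E.
have [m0 Pm0] := orderR_prime_ideal (Rs 0%N) (Ps 0%N).
have [m1 Pm1] := orderR_prime_ideal (Rs 1%N) (Ps 1%N).
have [n0 Pn0] := orderR_prime_ideal (Rt 0%N) (Pt 0%N).
have [n1 Pn1] := orderR_prime_ideal (Rt 1%N) (Pt 1%N).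
have /negP[] := varpi_residue (m0 * n1 + m1 * n0).
have Om (m : int) : (1 + alpha) * m%:~R \in 'O by inO.
have Os i : theta * s i \in 'O by case/andP: (Ps i).
have -> : theta ^+ 2 * varpi - (1 + alpha) ^+ 2 * (m0 * n1 + m1 * n0)%:~R =
    (theta * s 0%N) * (theta * t 1%N - (1 + alpha) * n1%:~R)
  + ((1 + alpha) * n1%:~R) * (theta * s 0%N - (1 + alpha) * m0%:~R)
  + (theta * s 1%N) * (theta * t 0%N - (1 + alpha) * n0%:~R)
  + ((1 + alpha) * n0%:~R) * (theta * s 1%N - (1 + alpha) * m1%:~R).
  by rewrite -E intrD !intrM; ring.
apply: rpredD; [apply: rpredD; [apply: rpredD |] |]; apply: prime_ideal_ideal => //;
exact: Os.
Qed.

(** The series varpi (X + d). *)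
Definition linear_fps (d : K) : fps A :=
  FPS (fun n => to_order (varpi * ((n == 1%N)%:R + d * (n == 0%N)%:R))).

Lemma linear_fps_coef d n : d \in 'O ->
  v (fps_coef (linear_fps d) n) = varpi * ((n == 1%N)%:R + d * (n == 0%N)%:R).
Proof.
move=> Od; rewrite to_orderK // conductor_orderR // conductorE mulrC mulKf ?varpi_neq0 //.
by rewrite rpredD ?rpredM ?rpred_nat.
Qed.

(** As g has a coefficient outside P, Gauss's lemma shows that f = varpi r with
    r over O, so that X + d = r g. If the constant term of g were in P, then the
    linear coefficient t of g would not be; but t d = g_0 - r_1 g_0 ^+ 2, where
    g_0 ^+ 2 is in I, so t d and hence d would be in R. Hence the constant term
    of r is in P. Its norm is a multiple of 9 other than 9 and -9 and divides
    27, and so the constant term of g has norm 1 or -1. *)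
Lemma linear_factor_unit d (f g : fps A) : d \in prime_ideal -> d \notin orderR ->
    `|fnorm d| = 27 -> linear_fps d = f * g ->
    (forall n, v (fps_coef f n) \in prime_ideal) ->
    (exists n, v (fps_coef g n) \notin prime_ideal) ->
  is_unit g.
Proof.
move=> Pd notRd Nd Dfg Pf [n0 notPg]; have nzv := varpi_neq0.
have Od := prime_ideal_O Pd.
pose s := v \o fps_coef f; pose t := v \o fps_coef g.
have Rs n : s n \in orderR by exact: order_val_R.
have Rt n : t n \in orderR by exact: order_val_R.
have [Os Ot] : (forall n, s n \in 'O) /\ (forall n, t n \in 'O).
  by split=> n; apply: orderR_O.
have Dst n : conv s t n = varpi * ((n == 1%N)%:R + d * (n == 0%N)%:R).
  by rewrite -linear_fps_coef // Dfg order_coefM.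
have Ots n : theta * s n \in 'O by case/andP: (Pf n).
have Pts n : theta * s n \in prime_ideal.
  have [] // := gauss_prime_ideal Ots Ot; last by move/(_ n0); rewrite (negPf notPg).
  move=> m; rewrite conv_scale Dst theta_conductor // conductorE mulrC mulKf //.
  by rewrite rpredD ?rpredM ?rpred_nat.
pose r n := varpi^-1 * s n.
have Or n : r n \in 'O by rewrite /r mulrC -conductorE prime_ideal_theta_conductor.
have Drt n : conv r t n = (n == 1%N)%:R + d * (n == 0%N)%:R.
  by rewrite /r conv_scale Dst mulKf.
have D0 : r 0%N * t 0%N = d.
  by have := Drt 0%N; rewrite /conv big_ord_recl big_ord0 addr0 /= add0r mulr1.
have D1 : r 0%N * t 1%N + r 1%N * t 0%N = 1.
  by have := Drt 1%N; rewrite /conv !big_ord_recl big_ord0 addr0 /= mulr0 addr0.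
have nzd : d != 0 by apply: contraNneq notRd => ->; rewrite rpred0.
have [nzr nzt] : r 0%N != 0 /\ t 0%N != 0 by apply/andP; rewrite -negb_or -mulf_eq0 D0.
have [Pt0|notPt0] := boolP (t 0%N \in prime_ideal).
  have notPt1 : t 1%N \notin prime_ideal.
    apply: contra one_notin_prime_ideal => Pt1.
    by rewrite -D1; apply: rpredD; apply: prime_ideal_ideal.
  case/negP: notRd; apply: (orderR_cancel (Rt 1%N)) => //.
  have -> : t 1%N * d = t 0%N - r 1%N * (t 0%N * t 0%N).
    have -> : r 1%N * (t 0%N * t 0%N) = (1 - r 0%N * t 1%N) * t 0%N.
      by rewrite -D1; ring.
    by rewrite -D0; ring.
  apply: rpredB; first exact: Rt.
  apply: conductor_orderR; apply: conductor_ideal; first exact: Or.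
  exact: prime_ideal_mul.
have Pr0 : r 0%N \in prime_ideal.
  by move: Pd; rewrite -D0 => /(prime_ideal_prime (Or _) (Ot _))[//|]; rewrite (negPf notPt0).
apply: fps_unit; apply/order_unitP; split; first exact: nzt.
apply: (orderR_unit (Rt 0%N) nzt); apply: (fnorm_unit (Ot 0%N)).
have [k [_ Dk k1]] := prime_ideal_fnorm Pr0; have [a [b [c Dt]]] := Z_adjoinP _ (Ot 0%N).
rewrite Dt fnorm_intr -intr_norm; rewrite -D0 fnormM Dk Dt fnorm_intr -intrM -intr_norm in Nd.
suff -> : `|norm_form a b c| = 1 by [].
move: k1 Nd; rewrite -[27]/(27%:~R) => + /intr_inj; rewrite !normrM.
by move: (norm_form a b c) => n; clear; nia.
Qed.

(** By Gauss's lemma P divides all coefficients of one of the factors, and not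
    of both because varpi, the linear coefficient of the product, is not in 9 Z
    + P^3; the factor with a coefficient outside P is a unit. *)
Lemma linear_irreducible d : d \in prime_ideal -> d \notin orderR -> `|fnorm d| = 27 ->
  irreducible (linear_fps d).
Proof.
move=> Pd notRd Nd; have nzv := varpi_neq0; have Od := prime_ideal_O Pd.
have nzd : d != 0 by apply: contraNneq notRd => ->; rewrite rpred0.
have coefE := fun n => linear_fps_coef n Od.
split.
- move/(congr1 (fun f => v (fps_coef f 1))); rewrite coefE /= mulr0 addr0 mulr1.
  exact/eqP.
- move/fps_unit_coef0/order_unitP; rewrite coefE /= mulr1 add0r => -[nz /orderR_O Ov].
  have Pvd : varpi * d \in prime_ideal by rewrite prime_ideal_ideal ?varpi_O.
  by rewrite (negPf (unit_notin_prime_ideal Ov nz)) in Pvd.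
move=> f g Dfg.
pose s := v \o fps_coef f; pose t := v \o fps_coef g.
have [Rs Rt] : (forall n, s n \in orderR) /\ (forall n, t n \in orderR).
  by split=> n; exact: order_val_R.
have Dst n : conv s t n = varpi * ((n == 1%N)%:R + d * (n == 0%N)%:R).
  by rewrite -coefE Dfg order_coefM.
have Pst n : conv s t n \in prime_ideal.
  by rewrite Dst mulrC prime_ideal_ideal ?varpi_prime_ideal // rpredD ?rpredM ?rpred_nat.
have [Ps|Pt] := gauss_prime_ideal (fun n => orderR_O (Rs n)) (fun n => orderR_O (Rt n)) Pst.
  have [Pt|/existsNP[n /negP notPt]] := EM (forall n, t n \in prime_ideal).
    by case: (conv_prime_ideal Rs Rt Ps Pt); rewrite Dst /= mulr0 addr0 mulr1.
  by right; apply: (linear_factor_unit Pd notRd Nd Dfg Ps); exists n.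
have [Ps|/existsNP[n /negP notPs]] := EM (forall n, s n \in prime_ideal).
  by case: (conv_prime_ideal Rs Rt Ps Pt); rewrite Dst /= mulr0 addr0 mulr1.
left; rewrite mulrC in Dfg.
by apply: (linear_factor_unit Pd notRd Nd Dfg Pt); exists n.
Qed.

Lemma three_alpha_facts : [/\ 3 * alpha \in prime_ideal, 3 * alpha \notin orderR,
  `|fnorm (3 * alpha)| = 27 & (3 * alpha) * (3 * alpha) \in conductor].
Proof.
have P3a : 3 * alpha \in prime_ideal by rewrite mulrC prime_ideal_ideal ?three_prime_ideal.
split=> //; [exact: three_alpha_notin_orderR | | exact: prime_ideal_mul].
by rewrite (@fnorm_eq 0 3 0) //; ring.
Qed.

Definition fps_val (f : fps A) : fps K := FPS (v \o fps_coef f).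

Lemma fps_val_inj : injective fps_val.
Proof.
move=> f g E; apply: fpsP => n; apply: order_val_inj.
exact: (congr1 (fun h : fps K => fps_coef h n) E).
Qed.

Lemma fps_valM f g : fps_val (f * g) = fps_val f * fps_val g.
Proof. by apply: fpsP => n; rewrite [LHS]order_coefM. Qed.

Lemma linear_fps_val d : d \in 'O ->
  fps_val (linear_fps d) = fpsC varpi * (fpsX K + fpsC d).
Proof.
move=> Od; apply: fpsP => n; rewrite fps_coef_mulC [LHS]linear_fps_coef //=.
by congr (_ * (_ + _)); case: (n == 0%N); rewrite ?mulr1 ?mulr0.
Qed.

Definition quadratic_fps (d : K) : fps A :=
  FPS (fun n => to_order ((n == 2%N)%:R - d * d * (n == 0%N)%:R)).

Lemma quadratic_fps_val d : d * d \in conductor ->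
  fps_val (quadratic_fps d) = fpsX K * fpsX K - fpsC d * fpsC d.
Proof.
move=> Id; apply: fpsP => n; rewrite -fpsCM.
transitivity (fps_coef (fpsX K * fpsX K) n - fps_coef (fpsC (d * d)) n); last by [].
rewrite fps_coef_X2 [LHS]to_orderK /=.
  by congr (_ - _); case: (n == 0%N); rewrite ?mulr1 ?mulr0.
rewrite rpredB ?rpred_nat // rpredM ?rpred_nat //; exact: conductor_orderR.
Qed.

(** With d = 3 alpha, the product of the two irreducibles varpi (X + d) and
    varpi (X - d) is varpi varpi (X ^+ 2 - d ^+ 2), a product of three nonunits,
    because varpi and d ^+ 2 are in I. *)
Lemma power_series_not_HFD : ~ HFD (fps A).
Proof.
move=> [_ atomic len]; have [Pd notRd Nd Id] := three_alpha_facts.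
set d := 3 * alpha in Pd notRd Nd Id; have nzv := varpi_neq0.
have Od := prime_ideal_O Pd.
have [Pd' notRd' Nd'] : [/\ - d \in prime_ideal, - d \notin orderR & `|fnorm (- d)| = 27].
  by rewrite !rpredN fnormN normrN.
have [PO Od'] : varpi \in 'O /\ - d \in 'O by rewrite varpi_O rpredN.
pose cv : fps A := fpsC (to_order varpi).
have Rv : varpi \in orderR by rewrite conductor_orderR // conductorE divff ?rpred1.
have cv_val : fps_val cv = fpsC varpi.
  by apply: fpsP => n; rewrite /= /comp /=; case: (n == 0%N); rewrite ?to_orderK ?order_val0.
have E : linear_fps d * linear_fps (- d) = cv * (cv * quadratic_fps d).
  apply: fps_val_inj; rewrite !fps_valM !linear_fps_val // cv_val quadratic_fps_val //.
  have -> : fpsC (- d) = - fpsC d by apply: fpsP => n /=; case: eqP; rewrite ?oppr0.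
  by ring.
have nzd : d != 0 by apply: contraNneq notRd => ->; rewrite rpred0.
have fact (f : fps A) : f <> 0 -> ~ is_unit f -> exists2 s, {in s, forall y, irreducible y} &
    f = \prod_(y <- s) y /\ (0 < size s)%N.
  move=> nzf nuf; have [s irr_s Df] := atomic f nzf nuf; exists s => //; split=> //.
  case: s {irr_s} Df => // Df; case: nuf; exists 1; rewrite Df big_nil mulr1 //.
have [||s irr_s [Ds s_gt0]] := fact cv.
- move/(congr1 (fun f : fps A => v (fps_coef f 0))); rewrite /= to_orderK //.
  exact/eqP.
- move/fps_unit_coef0/order_unitP; rewrite /= to_orderK // => -[_ /orderR_O Ov].
  by have := unit_notin_prime_ideal Ov nzv; rewrite varpi_prime_ideal.
have Dq n : v (fps_coef (quadratic_fps d) n) = (n == 2%N)%:R - d * d * (n == 0%N)%:R.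
  apply: to_orderK; rewrite rpredB ?rpred_nat // rpredM ?rpred_nat //.
  exact: conductor_orderR.
have [||t irr_t [Dt t_gt0]] := fact (quadratic_fps d).
- move/(congr1 (fun f : fps A => v (fps_coef f 2))); rewrite Dq /= mulr0 subr0.
  by move/eqP; rewrite oner_eq0.
- move/fps_unit_coef0/order_unitP; rewrite Dq /= mulr1 sub0r => -[nz /orderR_O Ov].
  by have := unit_notin_prime_ideal Ov nz; rewrite rpredN prime_ideal_ideal.
have := len [:: linear_fps d; linear_fps (- d)] (s ++ (s ++ t)).
rewrite !big_cat /= -Ds -Dt !big_cons big_nil mulr1 => /(_ _ _ E).
have irr2 : {in [:: linear_fps d; linear_fps (- d)], forall y, irreducible y}.
  by move=> y; rewrite !inE => /orP[] /eqP->; apply: linear_irreducible.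
have irr3 : {in s ++ (s ++ t), forall y, irreducible y}.
  by move=> y; rewrite !mem_cat => /or3P[/irr_s|/irr_s|/irr_t].
move=> /(_ irr2 irr3); rewrite !size_cat; move: s_gt0 t_gt0; clear.
by case: (size s) => // m; case: (size t) => // n _ _; rewrite addnC !addnS.
Qed.

End Field.

Theorem theorem6p8 (K : fieldExtType rat) (alpha : K)
    (alpha_root : root ('X^3 + 4 *: 'X - 1 : {poly K}) alpha)
    (alpha_gen : <<1; alpha>>%VS = {:K}%VS) :
  ring_of_integers K =i Z_adjoin alpha /\
  let P := ideal_gen [:: 3; 2 + 2 * alpha + alpha ^+ 2] in
  let I := ideal_mul P P in
  exists R : number_order K,
    [/\ order_pred R =i Z_plus I,
        HFD (order_ring R)
      & ~ HFD (fps (order_ring R))].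
Proof.
split=> [|P I]; first exact: ring_of_integersE alpha_root alpha_gen.
have IE : I =i conductor alpha.
  by apply: ideal_mulE => //; apply: ideal_genE.
exists (the_order alpha_root alpha_gen); split.
- exact: Z_plusE.
- exact: order_HFD.
exact: power_series_not_HFD.
Qed.
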